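(* Let $(\mathbb{K},[\cdot,\cdot])$ be a Krein space with fundamental symmetry $J$, and let $T$ be a bounded surjective linear operator on $\mathbb{K}$ such that (i) $T$ preserves definiteness with sign; (ii) $T$ preserves maximality; (iii) $T$ preserves regularity. Then $\{(T(W_i),v_i):i\in I\}$ is a $J$-fusion frame for $\mathbb{K}$ whenever $\{(W_i,v_i):i\in I\}$ is a $J$-fusion frame for $\mathbb{K}$.
   Context: $\langle f,g\rangle_J=[Jf,g]$ is the Hilbert space inner product of $\mathbb{K}$ and $\|\cdot\|_J$ its norm. For a closed subspace $W$, $\pi_W$ is the orthogonal projection onto $W$ with respect to $\langle\cdot,\cdot\rangle_J$. $V^{[\perp]}=\{g:[g,f]=0\ \forall f\in V\}$. A subspace $W$ is $J$-non-negative (resp. $J$-non-positive) if $[f,f]\ge 0$ (resp. $\le 0$) for all $f\in W$; $J$-negative if $[f,f]<0$ for all nonzero $f\in W$; uniformly $J$-positive (resp. uniformly $J$-negative) if there is $\alpha>0$ with $[f,f]\ge\alpha\|f\|_J^2$ (resp. $-[f,f]\ge\alpha\|f\|_J^2$) for all $f\in W$. Maximality is with respect to inclusion. Let $\mu^+$ (resp. $\mu^-$) be the set of all closed uniformly $J$-positive (resp. closed uniformly $J$-negative) subspaces of $\mathbb{K}$. Let $\Psi(\mathbb{K})$ be the set of maximal subspaces of $\mathbb{K}$, i.e. subspaces that are maximal $J$-non-negative or maximal $J$-non-positive. Let $\Omega(\mathbb{K})$ be the set of regular (projectively complete) subspaces, i.e. closed subspaces $V$ with $\mathbb{K}=V\oplus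 V^{[\perp]}$ (direct sum). A bounded linear operator $T$ on $\mathbb{K}$ preserves definiteness with sign if $V\in\mu^+$ implies $T(V)\in\mu^+$ and $V\in\mu^-$ implies $T(V)\in\mu^-$; it preserves maximality if $V\in\Psi(\mathbb{K})$ implies $T(V)\in\Psi(\mathbb{K})$; it preserves regularity if $V\in\Omega(\mathbb{K})$ implies $T(V)\in\Omega(\mathbb{K})$. Families $\{(W_i,v_i):i\in I\}$ consist of closed subspaces $W_i$ of $\mathbb{K}$ with weights $v_i>0$, where each $W_i$ is either $J$-non-negative or $J$-negative. $I_+$ is the set of $i$ with $W_i$ $J$-non-negative, and $I_-$ the set of $i$ with $W_i\neq\{0\}$ and $W_i$ $J$-negative. The family is Bessel if $\sum_{i}v_i^2\|\pi_{W_i}f\|_J^2\le B\|f\|_J^2$ for some $B<\infty$ and all $f\in\mathbb{K}$. Let $(\sum_{i\in I}\oplus W_i)_{\ell_2}$ be the Hilbert space of families $\{f_i\}$, $f_i\in W_i$, with $\sum\|f_i\|_J^2<\infty$. The synthesis operator is $T_{W,v}\{f_i\}=\sum_{i\in I}v_if_i$. Let $P_\pm$ be the orthogonal projection of this space onto $(\sum_{i\in I_\pm}\oplus W_i)_{\ell_2}$, and ${T_{W,v}}_\pm=T_{W,v}P_\pm$. The Bessel family is a $J$-fusion frame for $\mathbb{K}$ if the range $R({T_{W,v}}_+)$ is a maximal uniformly $J$-positive subspace and $R({T_{W,v}}_-)$ is a maximal uniformly $J$-negative subspace of $\mathbb{K}$. *)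

(* Defs.v *)
From HB Require Import structures.
From mathcomp Require Import all_boot all_order all_algebra.
From mathcomp Require Import complex.
From mathcomp Require Import all_classical all_reals all_analysis.
From mathcomp.analysis.showcase Require summability.

Set Implicit Arguments.
Unset Strict Implicit.
Unset Printing Implicit Defensive.

Import Order.TTheory GRing.Theory Num.Theory.
Import numFieldNormedType.Exports.

Local Open Scope classical_set_scope.
Local Open Scope ring_scope.
Local Open Scope complex_scope.

(* A complex Krein space together with a fundamental symmetry J, that is a
   linear map with J = J^{-1} that is symmetric for the indefinite inner
   product [., .] and such that <f, g>_J = [J f, g] is a Hilbert space inner
   product.  The carrier is a complete normed space whose norm is the J-norm,
   so its topology is the (strong) topology of the Krein space; positivity of
   <., .>_J comes from [kspace_norm].  The associated fundamental decomposition
   is given by the kernels of J - 1 and J + 1. *)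
Record kreinSpace (R : realType) := KreinSpace {
  kspace :> completeNormedModType R[i];
  kform : {hermitian_sym kspace for (@Num.conj R[i])};
  ksym : {linear kspace -> kspace};
  ksymK : forall f : kspace, ksym (ksym f) = f;
  ksym_adj : forall f g : kspace, kform (ksym f) g = kform f (ksym g);
  kspace_norm : forall f : kspace, kform (ksym f) f = `|f| ^+ 2
}.

Section Krein.
Context {R : realType} {K : kreinSpace R}.
Implicit Types (V : set K) (f g : K).

Definition jdot f g : R[i] := kform K (ksym K f) g.

Definition jnorm f : R := Num.sqrt (complex.Re (jdot f f)).

Definition subspace V :=
  V 0 /\ forall (a : R[i]) f g, V f -> V g -> V (a *: f + g).

Definition closed_subspace V := subspace V /\ closed V.

Definition korth V : set K := [set g | forall f, V f -> kform K g f = 0].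

(* The order of R[i] is the partial order x <= y <-> 0 <= y - x (in particular
   y - x is real); [f, f] is always real since the form is Hermitian. *)
Definition Jnonneg V := forall f, V f -> 0 <= kform K f f.
Definition Jnonpos V := forall f, V f -> kform K f f <= 0.
Definition Jneg V := forall f, V f -> f <> 0 -> kform K f f < 0.

Definition unif_Jpos V := exists2 alpha : R, 0 < alpha &
  forall f, V f -> (alpha * jnorm f ^+ 2)%:C <= kform K f f.
Definition unif_Jneg V := exists2 alpha : R, 0 < alpha &
  forall f, V f -> (alpha * jnorm f ^+ 2)%:C <= - kform K f f.

Definition maximal_subspace (P : set K -> Prop) V :=
  [/\ subspace V, P V &
      forall U : set K, subspace U -> P U -> V `<=` U -> U = V].

Definition mu_pos V := closed_subspace V /\ unif_Jpos V.
Definition mu_neg V := closed_subspace V /\ unif_Jneg V.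

Definition Psi V := maximal_subspace Jnonneg V \/ maximal_subspace Jnonpos V.

Definition Omega V :=
  [/\ closed_subspace V, V `&` korth V = [set 0] &
      forall f, exists g h, [/\ V g, korth V h & f = g + h]].

Definition bounded_operator (T : {linear K -> K}) :=
  exists M : R, forall f, jnorm (T f) <= M * jnorm f.

Definition preserves_definiteness_with_sign (T : {linear K -> K}) :=
  (forall V, mu_pos V -> mu_pos (T @` V)) /\
  (forall V, mu_neg V -> mu_neg (T @` V)).

Definition preserves_maximality (T : {linear K -> K}) :=
  forall V, Psi V -> Psi (T @` V).

Definition preserves_regularity (T : {linear K -> K}) :=
  forall V, Omega V -> Omega (T @` V).

(* Orthogonal projection onto a closed subspace V: the unique point p of V with
   f - p orthogonal to V for <., .>_J. *)
Definition jproj V f : K :=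
  xget 0 [set p | V p /\ forall g, V g -> jdot (f - p) g = 0].

Section Families.
Context {I : choiceType}.
Implicit Types (W : I -> set K) (v : I -> R) (x : I -> K).

Definition weighted_family W v := forall i,
  [/\ closed_subspace (W i), 0 < v i & Jnonneg (W i) \/ Jneg (W i)].

Definition Iplus W : set I := [set i | Jnonneg (W i)].
Definition Iminus W : set I := [set i | W i <> [set 0] /\ Jneg (W i)].

Definition Bessel W v := exists B : R, forall f,
  (\esum_(i in [set: I]) (v i ^+ 2 * jnorm (jproj (W i) f) ^+ 2)%:E
     <= (B * jnorm f ^+ 2)%:E)%E.

Definition ell2_sum W : set (I -> K) :=
  [set x | (forall i, W i (x i)) /\
           (\esum_(i in [set: I]) (jnorm (x i) ^+ 2)%:E < +oo)%E].

(* [summability.sum] is the limit of the net of finite partial sums. *)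
Definition synthesis v x : K := summability.sum (fun i => (v i)%:C *: x i).

(* The orthogonal projection of the l2-sum of the W i, i in I, onto the l2-sum
   of the W i, i in A, keeps the coordinates in A and annihilates the others. *)
Definition coord_proj (A : set I) x : I -> K := patch (fun=> 0) A x.

Definition range_synthesis_on (A : set I) W v : set K :=
  [set synthesis v (coord_proj A x) | x in ell2_sum W].

Definition J_fusion_frame W v :=
  [/\ weighted_family W v, Bessel W v,
      maximal_subspace unif_Jpos (range_synthesis_on (Iplus W) W v) &
      maximal_subspace unif_Jneg (range_synthesis_on (Iminus W) W v)].

End Families.
End Krein.

(* Main.v *)
Require Import Defs.
From mathcomp Require Import all_boot all_order all_algebra.
From mathcomp Require Import complex.
From mathcomp Require Import all_classical all_reals all_analysis.
From mathcomp Require Import finmap ring lra.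
From mathcomp.analysis.showcase Require summability.

Set Implicit Arguments.
Unset Strict Implicit.
Unset Printing Implicit Defensive.
Import Order.TTheory GRing.Theory Num.Theory.
Import numFieldNormedType.Exports.
Import Defs.
Local Open Scope classical_set_scope.
Local Open Scope ring_scope.
Local Open Scope complex_scope.

(* Write q f = [f, f].  If q takes both signs, then T is injective (adding to a
   kernel vector small multiples of arbitrary vectors would force q to be
   semidefinite on R(T) = K) and q (T x) has the sign of q x; comparing the
   roots of t |-> q (x + t y) and of t |-> q (T (x + t y)) for q x > 0 > q y
   gives q (T x) = c q x with a constant c > 0.  Evaluating on J x + x and
   J x - x, this bounds T below, so T is a homeomorphism and everything is
   transported along T.

   If q is semidefinite, then J = 1 or J = -1, every closed subspace is uniformly
   definite, so that T maps closed subspaces to closed subspaces; but T may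
   fail to be injective.
   The ranges are then K and {0}, and the only issue is the Bessel property.
   Since T is onto, the open mapping theorem bounds T below on (ker T)^perp.
   The kernel is finite-dimensional: otherwise it contains an orthonormal
   sequence e_n, and the closed subspace
   {v | <T v, e_n> = 3^-n <v, e_n> for all n} has an image which is not closed.
   Hence |w|^2 <= sum_(e in s) <w, e>^2 + C^2 |T w|^2 for a finite s, and the
   finitely many error terms |pi_(W_i) e|^2 are summable because (W_i, v_i) is
   itself Bessel. *)

(** * The underlying real Hilbert space *)

Section RealStructure.
Context {R : realType} {K : kreinSpace R}.
Implicit Types (f g h x y z : K) (a b t : R).

(** Taking real parts reduces the estimates to real arithmetic; [jdot_rip] recovers the complex
    product from [rip]. *)
Definition rip f g : R := complex.Re (jdot f g).
Definition qf f : R := complex.Re (kform K f f).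
Definition qb f g : R := complex.Re (kform K f g).

Lemma kformC f g : kform K f g = (kform K g f)^*%C.
Proof. by rewrite hermC expr0 mul1r. Qed.

Lemma jdotC f g : jdot f g = (jdot g f)^*%C.
Proof. by rewrite /jdot kformC ksym_adj. Qed.

Lemma kform_qf f : kform K f f = (qf f)%:C.
Proof.
have := kformC f f; rewrite /qf; case: (kform K f f) => a b /eqP.
by rewrite eq_complex /= eqxx -addr_eq0 -mulr2n mulrn_eq0 => /eqP ->.
Qed.

Lemma qfE f : qf f = qb f f. Proof. by []. Qed.

Lemma ripC f g : rip f g = rip g f.
Proof. by rewrite /rip jdotC; case: (jdot g f). Qed.

Lemma qbC f g : qb f g = qb g f.
Proof. by rewrite /qb kformC; case: (kform K g f). Qed.

Lemma kformZr (c : R[i]) f g : kform K f (c *: g) = c^*%C * kform K f g.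
Proof. by rewrite kformC linearZl_LR rmorphM /= -kformC. Qed.

Lemma ReD (z w : R[i]) : complex.Re (z + w) = complex.Re z + complex.Re w.
Proof. by case: z w => ? ? []. Qed.

Lemma ReZ a (w : R[i]) : complex.Re (a%:C * w) = a * complex.Re w.
Proof. by case: w => ? ? /=; rewrite mul0r subr0. Qed.

Lemma qbDl f g h : qb (f + g) h = qb f h + qb g h.
Proof. by rewrite /qb linearDl ReD. Qed.

Lemma qbZl a f h : qb (a%:C *: f) h = a * qb f h.
Proof. by rewrite /qb linearZl_LR ReZ. Qed.

Lemma ripE f g : rip f g = qb (ksym K f) g. Proof. by []. Qed.

Lemma ripDl f g h : rip (f + g) h = rip f h + rip g h.
Proof. by rewrite !ripE linearD qbDl. Qed.

Lemma ripZl a f h : rip (a%:C *: f) h = a * rip f h.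
Proof. by rewrite !ripE linearZ qbZl. Qed.

Lemma ripDr f g h : rip h (f + g) = rip h f + rip h g.
Proof. by rewrite !(ripC h) ripDl. Qed.

Lemma ripZr a f h : rip h (a%:C *: f) = a * rip h f.
Proof. by rewrite !(ripC h) ripZl. Qed.

Lemma scaleN1c f : - f = (-1)%:C *: f.
Proof. by rewrite rmorphN rmorph1 scaleN1r. Qed.

Lemma ripNl f h : rip (- f) h = - rip f h.
Proof. by rewrite scaleN1c ripZl mulN1r. Qed.

Lemma ripNr f h : rip h (- f) = - rip h f.
Proof. by rewrite !(ripC h) ripNl. Qed.

Lemma rip0l h : rip 0 h = 0.
Proof. by rewrite -(subrr h) ripDl ripNl subrr. Qed.

Lemma rip0r h : rip h 0 = 0. Proof. by rewrite ripC rip0l. Qed.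

Lemma jdot_rip f g : jdot f g = (rip f g)%:C + 'i%C * (rip f ('i%C *: g))%:C.
Proof.
rewrite {1}[jdot f g]complexE /rip; congr (_ + _ * _%:C).
rewrite /jdot kformZr.
by case: (kform K _ g : R[i]) => a b /=; simpc.
Qed.

Lemma rip_ii f g : rip ('i%C *: f) ('i%C *: g) = rip f g.
Proof.
rewrite /rip /jdot kformZr linearZ linearZl_LR.
suff -> : ('i%C : R[i])^*%C * ('i%C * kform K (ksym K f) g) = kform K (ksym K f) g by [].
rewrite mulrA (_ : ('i%C : R[i])^*%C * 'i%C = 1) ?mul1r //; apply/eqP.
by rewrite eq_complex /= ?mul0r ?mulr0 ?add0r ?addr0 mulN1r opprK !eqxx.
Qed.

Lemma normKE f : `|f| = (jnorm f)%:C.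
Proof.
rewrite /jnorm /jdot kspace_norm.
have := normr_ge0 f; case: `|f| => a b; rewrite lecE /= => /andP[/eqP -> a0].
by congr (_ +i* _); rewrite ?mul0r ?mulr0 ?subr0 -expr2 sqrtr_sqr ger0_norm.
Qed.

Lemma jnorm_ge0 f : 0 <= jnorm f. Proof. exact: sqrtr_ge0. Qed.

Lemma rip_norm f : rip f f = jnorm f ^+ 2.
Proof.
by rewrite /rip /jdot kspace_norm normKE -rmorphXn.
Qed.

Lemma jnorm0 : jnorm (0 : K) = 0.
Proof. by apply/eqP; rewrite -sqrf_eq0 -rip_norm rip0l. Qed.

Lemma jnorm_eq0 f : jnorm f = 0 -> f = 0.
Proof. by move=> f0; apply/normr0_eq0; rewrite normKE f0. Qed.

Lemma jnorm_gt0 f : f != 0 -> 0 < jnorm f.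
Proof.
move=> f0; rewrite lt_def jnorm_ge0 andbT; apply: contra f0 => /eqP.
by move/jnorm_eq0 ->.
Qed.

Lemma jnormN f : jnorm (- f) = jnorm f.
Proof. by apply: complexI; rewrite -!normKE normrN. Qed.

Lemma jnormB f g : jnorm (f - g) = jnorm (g - f).
Proof. by rewrite -jnormN opprB. Qed.

Lemma jnormZ a f : jnorm (a%:C *: f) = `|a| * jnorm f.
Proof.
apply: complexI; rewrite rmorphM /= -!normKE normrZ normc_def /=.
by rewrite expr0n addr0 sqrtr_sqr.
Qed.

Lemma jnormD f g : jnorm (f + g) <= jnorm f + jnorm g.
Proof. by rewrite -lecR rmorphD /= -!normKE ler_normD. Qed.

Lemma jnormDB f g h : jnorm (f - h) <= jnorm (f - g) + jnorm (g - h).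
Proof. by apply: le_trans (jnormD _ _); rewrite addrA subrK. Qed.

Lemma rip_sqrD f g : jnorm (f + g) ^+ 2 = jnorm f ^+ 2 + 2 * rip f g + jnorm g ^+ 2.
Proof. by rewrite -!rip_norm ripDl !ripDr (ripC g f); ring. Qed.

Lemma rip_sqrB f g : jnorm (f - g) ^+ 2 = jnorm f ^+ 2 - 2 * rip f g + jnorm g ^+ 2.
Proof. by rewrite rip_sqrD ripNr jnormN; ring. Qed.

Lemma rip_le f g : rip f g <= jnorm f * jnorm g.
Proof.
rewrite -(ler_pM2l (ltr0n R 2)) -(lerD2l (jnorm f ^+ 2)) -(lerD2r (jnorm g ^+ 2)).
rewrite -rip_sqrD (le_trans (_ : _ <= (jnorm f + jnorm g) ^+ 2)) //.
  by rewrite lerXn2r ?nnegrE ?addr_ge0 ?jnorm_ge0 ?jnormD.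
by rewrite le_eqVlt; apply/orP; left; apply/eqP; ring.
Qed.

Lemma rip_le_abs f g : `|rip f g| <= jnorm f * jnorm g.
Proof.
rewrite ler_norml rip_le andbT lerNl -ripNl (le_trans (rip_le _ _)) //.
by rewrite jnormN.
Qed.

Lemma jnorm_ksym f : jnorm (ksym K f) = jnorm f.
Proof. by rewrite /jnorm /jdot ksymK -ksym_adj. Qed.

Lemma qf_jdot f : qf f = rip (ksym K f) f.
Proof. by rewrite ripE ksymK. Qed.

Lemma qfD f g : qf (f + g) = qf f + 2 * qb f g + qf g.
Proof. by rewrite !qfE qbDl !(qbC _ (f + g)) !qbDl (qbC g f); ring. Qed.

Lemma qfZ a f : qf (a%:C *: f) = a ^+ 2 * qf f.
Proof. by rewrite !qfE qbZl qbC qbZl mulrA -expr2. Qed.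

Lemma qbZr a f h : qb h (a%:C *: f) = a * qb h f.
Proof. by rewrite !(qbC h) qbZl. Qed.

Lemma qf0 : qf (0 : K) = 0.
Proof. by rewrite -(scale0r (0 : K)) (qfZ 0) expr0n mul0r. Qed.

Lemma closedP (V : set K) :
  closed V <-> forall l, (forall e : R, 0 < e -> exists2 u, V u & jnorm (l - u) < e) -> V l.
Proof.
split=> [cV l Hl|H].
  rewrite closure_id in cV; rewrite cV => B /nbhs_ballP[e /= e0 Be].
  (* Positivity in [R[i]] includes a zero imaginary part, so the radius is real. *)
  have eE : e = (complex.Re e)%:C.
    by move: e0; case: (e) => ? ?; rewrite ltcE /= => /andP[/eqP ->].
  have [|u Vu lu] := Hl (complex.Re e); first by rewrite -ltcR -eE.
  exists u; split => //; apply: Be; rewrite -ball_normE /ball_ /= normKE eE ltcR //.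
rewrite closure_id eqEsubset; split; first exact: subset_closure.
move=> l cl; apply: H => e e0.
have [] := cl (ball l e%:C); first by apply: nbhsx_ballx; rewrite ltcR.
move=> u []; rewrite -ball_normE /ball_ /= normKE ltcR => Vu lu.
by exists u.
Qed.

(** Completeness with an explicit rate: the Cauchy modulus [d] survives the passage to the limit. *)
Lemma rcomplete (u : nat -> K) (d : nat -> R) :
  (forall n m, (n <= m)%N -> jnorm (u n - u m) <= d n) ->
  (forall e : R, 0 < e -> exists n, d n < e) ->
  exists l, forall n, jnorm (u n - l) <= d n.
Proof.
move=> ud d0.
have cu : cvg (u @ \oo).
  apply: cauchy_cvg; apply: cauchy_exP => e e0.
  have eE : e = (complex.Re e)%:C.
    by move: e0; case: (e) => ? ?; rewrite ltcE /= => /andP[/eqP ->].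
  have [|n dn] := d0 (complex.Re e); first by rewrite -ltcR -eE.
  exists (u n); exists n => // m /= nm.
  by rewrite -ball_normE /ball_ /= normKE eE ltcR (le_lt_trans (ud _ _ nm)).
exists (lim (u @ \oo)) => n; apply/ler_addgt0Pl => e e0.
have := cu; move/cvgrPdist_lt => /(_ e%:C); rewrite ltcR => /(_ e0)[N _ HN].
have := HN (maxn n N) (leq_maxr _ _); rewrite /= normKE ltcR => lu.
apply: le_trans (jnormDB _ (u (maxn n N)) _) _.
by rewrite addrC lerD ?ud ?leq_maxl // jnormB ltW.
Qed.

End RealStructure.

(** * Orthogonal projection and Riesz representation *)

Section Hilbert.
Context {R : realType} {K : kreinSpace R}.
Implicit Types (f g h x y z : K) (a b t : R) (V : set K).

(** Real scalars only, because projections are also taken onto the kernel of a real functional and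
    onto the range of an adjoint for [rip]. *)
Definition rsubspace V :=
  V 0 /\ forall a f g, V f -> V g -> V (a%:C *: f + g).

Lemma subspace_rsubspace V : subspace V -> rsubspace V.
Proof. by case=> V0 VD; split=> // a; exact: VD. Qed.

(** The first-order condition at a minimum; testing at [t = b / (c + 1)] suffices. *)
Lemma linear_le_square_eq0 b c : 0 <= c -> (forall t, 2 * t * b <= t ^+ 2 * c) -> b = 0.
Proof.
move=> c0 H; have c1 : 0 < c + 1 by lra.
have := H (b / (c + 1)).
have bE : b = b / (c + 1) * (c + 1) by rewrite divfK // gt_eqF.
move: (b / (c + 1)) bE => s bE sH.
suff s0 : s = 0 by rewrite bE s0 mul0r.
apply/eqP; rewrite -sqrf_eq0 eq_le sqr_ge0 andbT.
by move: sH; rewrite bE => sH; have := sqr_ge0 s; nra.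
Qed.

Lemma inv_succ_lt (e : R) : 0 < e -> exists n : nat, n.+1%:R^-1 < e.
Proof.
move=> e0; exists (Num.truncn e^-1).
by rewrite -ltf_pV2 ?posrE ?invr_gt0 // invrK truncnS_gt.
Qed.

(** A minimising sequence is Cauchy by the parallelogram law, and at its limit the first variation
    of the squared distance vanishes. *)
Lemma rproj_exists V f : rsubspace V -> closed V ->
  exists2 p, V p & forall g, V g -> rip (f - p) g = 0.
Proof.
move=> [V0 VD] /closedP cV.
pose A := [set jnorm (f - g) | g in V].
have iA : has_inf A.
  split; first by exists (jnorm (f - 0)), 0.
  by exists 0 => _ [g _ <-]; exact: jnorm_ge0.
set d := inf A.
have d_le g : V g -> d <= jnorm (f - g) by move=> Vg; apply: ge_inf; [case: iA|exists g].
have d_ge0 : 0 <= d by apply: lb_le_inf; [case: iA | move=> _ [g _ <-]; exact: jnorm_ge0].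
pose del n : R := n.+1%:R^-1.
have del0 n : 0 < del n by rewrite invr_gt0.
have del1 n : del n <= 1 by rewrite invf_le1 // ler1n.
have delle n m : (n <= m)%N -> del m <= del n by move=> ?; rewrite lef_pV2 ?posrE // ler_nat.
(* The tolerance is matched to the parallelogram law: [|u n - u m|^2 <= 4 (d + eta n)^2 - 4 d^2 <= 4
   (2 d + 1) eta n = (del n)^2], using [eta n <= 1]. *)
pose eta n := del n ^+ 2 / (4 * (2 * d + 1)).
have d1 : 0 < 4 * (2 * d + 1) by lra.
have eta0 n : 0 < eta n by rewrite divr_gt0 // exprn_gt0.
have etaE n : eta n * (4 * (2 * d + 1)) = del n ^+ 2 by rewrite /eta divfK // gt_eqF.
have /choice[u Hu] n : exists g, V g /\ jnorm (f - g) < d + eta n.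
  by have [_ [g Vg <-] ?] := inf_adherent (eta0 n) iA; exists g.
have eta_le n m : (n <= m)%N -> eta m <= eta n.
  move=> nm; rewrite /eta ler_pM2r ?invr_gt0 //; apply: lerXn2r; rewrite ?nnegrE ?(ltW (del0 _)) ?delle //.
have ud n m : (n <= m)%N -> jnorm (u n - u m) <= del n.
  move=> nm; rewrite -(@ler_pXn2r _ 2) ?nnegrE ?jnorm_ge0 ?ltW //.
  have [Vn un] := Hu n; have [Vm um] := Hu m.
  have Vh : V ((2^-1)%:C *: (u n + u m)).
    rewrite scalerDr; apply: (VD) => //; rewrite -[_ *: _]addr0; exact: VD.
  have /d_le := Vh; have -> : f - (2^-1)%:C *: (u n + u m) = (2^-1)%:C *: ((f - u n) + (f - u m)).
    rewrite addrACA -opprD scalerBr; congr (_ - _).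
    by rewrite scalerDr -scalerDl -rmorphD (_ : _ + _ = 1) ?rmorph1 ?scale1r //; lra.
  have -> : u n - u m = (f - u m) - (f - u n) by rewrite opprB [RHS]addrC addrA subrK.
  rewrite jnormZ ger0_norm ?invr_ge0 //.
  have := rip_sqrD (f - u n) (f - u m); have := rip_sqrB (f - u m) (f - u n).
  rewrite (ripC (f - u m)).
  have := eta_le _ _ nm; have := etaE n; have := eta0 n; have := eta0 m.
  have := del1 n; have := del0 n.
  have := jnorm_ge0 ((f - u n) + (f - u m)); have := jnorm_ge0 (f - u n); have := jnorm_ge0 (f - u m).
  move: un um; set x := jnorm (f - u n); set y := jnorm (f - u m); set z := jnorm (_ + _).
  set w := jnorm _; set r := rip _ _; set e1 := eta n; set e2 := eta m; set dl := del n.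
  move=> un um y0 x0 z0 dl0 dl1 e20 e10 E e21 -> zE dz.
  have hz : 4 * d ^+ 2 <= z ^+ 2 by nra.
  have hx : x ^+ 2 <= (d + e1) ^+ 2 by nra.
  have hy : y ^+ 2 <= (d + e1) ^+ 2 by nra.
  have he : e1 <= 1 by nra.
  have he2 : e1 ^+ 2 <= e1 by nra.
  nra.
have [|p Hp] := rcomplete ud; first exact: inv_succ_lt.
have Vp : V p.
  apply: cV => e /inv_succ_lt[n ne]; exists (u n); first by case: (Hu n).
  by rewrite jnormB (le_lt_trans (Hp n)).
have dp : jnorm (f - p) <= d.
  apply/ler_addgt0Pl => e e0; have [|n ne] := @inv_succ_lt (e / 2); first by rewrite divr_gt0.
  apply: le_trans (jnormDB _ (u n) _) _.
  have [_ un] := Hu n; have := Hp n; have := etaE n; have := del0 n; have := del1 n; have := eta0 n.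
  move: un ne; rewrite -/(del n); move: (eta n) (del n) => e1 dl *.
  nra.
exists p => // g Vg; apply: (@linear_le_square_eq0 _ (jnorm g ^+ 2)); first exact: sqr_ge0.
move=> t; have /d_le : V (t%:C *: g + p) by exact: VD.
rewrite (addrC _ p) opprD addrA => H.
have := rip_sqrB (f - p) (t%:C *: g); rewrite ripZr jnormZ exprMn real_normK ?num_real //.
have := jnorm_ge0 (f - p); nra.
Qed.

Lemma jproj_mem V f : subspace V -> V (jproj V f).
Proof. by move=> [V0 _]; rewrite /jproj; case: xgetP => [p -> []|_]. Qed.

(** The identity also holds for the default value 0 of [jproj], so it applies to images under [T]
    before they are known to be closed. *)
Lemma jproj_sqr V f : subspace V -> jnorm (jproj V f) ^+ 2 = rip f (jproj V f).
Proof.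
move=> sV; have := jproj_mem f sV; rewrite /jproj; case: xgetP => [p -> [Vp H] _|_ _].
  have := congr1 (@complex.Re R) (H _ Vp); rewrite -/(rip _ _) ripDl ripNl rip_norm /= => /eqP.
  by rewrite subr_eq0 => /eqP ->.
by rewrite jnorm0 rip0r expr0n.
Qed.

Lemma rip_jproj V f g : closed_subspace V -> V g -> rip f g = rip (jproj V f) g.
Proof.
move=> [sV cV] Vg; have [p Vp Hp] := rproj_exists f (subspace_rsubspace sV) cV.
rewrite /jproj; case: xgetP => [q -> [Vq H]|/(_ p)[]].
  have := congr1 (@complex.Re R) (H _ Vg); rewrite -/(rip _ _) ripDl ripNl => /eqP.
  by rewrite subr_eq0 => /eqP.
(* [V] is stable under multiplication by ['i], so orthogonality for [rip] gives orthogonality for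
   the complex product. *)
split=> // h Vh; rewrite jdot_rip !Hp ?rmorph0 ?mulr0 ?addr0 //.
by rewrite -[_ *: _]addr0; apply: (proj2 sV); case: sV.
Qed.

Lemma rip_le_jproj V f g : closed_subspace V -> V g ->
  rip f g <= jnorm (jproj V f) * jnorm g.
Proof. by move=> cV Vg; rewrite (rip_jproj f cV Vg) rip_le. Qed.

Lemma jproj_le V f : subspace V -> jnorm (jproj V f) <= jnorm f.
Proof.
move=> sV; have := jproj_sqr f sV; have := rip_le f (jproj V f).
have := jnorm_ge0 f; have := jnorm_ge0 (jproj V f).
set p := jnorm _; set n := jnorm _; set r := rip _ _ => p0 n0 H rE; nra.
Qed.

(** A nonzero normal [z] to the kernel of [phi] represents [phi] once rescaled by
    [phi z / |z|^2]. *)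
Lemma riesz (phi : K -> R) (M : R) :
  (forall a x y, phi (a%:C *: x + y) = a * phi x + phi y) ->
  (forall x, `|phi x| <= M * jnorm x) ->
  exists h, forall x, phi x = rip h x.
Proof.
move=> phiL phiM.
have phi0 : phi 0 = 0.
  by have := phiL 1 0 0; rewrite rmorph1 scale1r addr0 mul1r => /eqP; rewrite -subr_eq subrr => /eqP.
have [allz|/existsNP[x0 /eqP x0P]] := pselect (forall x, phi x = 0).
  by exists 0 => x; rewrite rip0l.
pose V := [set x | phi x = 0].
have sV : rsubspace V by split=> // a f g; rewrite /V /= phiL => -> ->; rewrite mulr0 addr0.
have phiB x y : phi (x - y) = phi x - phi y.
  by rewrite addrC scaleN1c phiL mulN1r addrC.
have M0 : 0 <= M.
  have := phiM x0; have := jnorm_ge0 x0; have : 0 < `|phi x0| by rewrite normr_gt0.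
  by move=> *; nra.
have cV : closed V.
  apply/closedP => l Hl; apply/eqP; rewrite /V -normr_le0; apply/ler_addgt0Pl => e e0.
  have [|u] := Hl (e / (M + 1)); first by rewrite divr_gt0 // ltr_wpDl.
  rewrite /V /= => u0; rewrite ltr_pdivlMr ?ltr_wpDl // => lu.
  have := phiM (l - u); rewrite phiB u0 subr0 addr0.
  have := jnorm_ge0 (l - u); set n := jnorm _ in lu * => ? ?; nra.
have [p Vp Hp] := rproj_exists x0 sV cV.
pose z := x0 - p.
have phz : phi z = phi x0 by rewrite /z phiB Vp subr0.
have z0 : jnorm z ^+ 2 != 0.
  rewrite sqrf_eq0; apply: contra x0P => /eqP/jnorm_eq0 z0.
  by rewrite -phz z0 phi0.
exists ((phi z / jnorm z ^+ 2)%:C *: z) => x; rewrite ripZl.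
have /Hp : V ((- (phi x / phi z))%:C *: z + x) by rewrite /V /= phiL phz mulNr divfK // addNr.
rewrite -/z ripDr ripZr rip_norm => H.
have -> : rip z x = phi x / phi z * jnorm z ^+ 2 by apply/eqP; rewrite -subr_eq0 -mulNr addrC H.
have phz0 : phi z != 0 by rewrite phz.
by field; rewrite phz0; move: z0; rewrite sqrf_eq0.
Qed.

End Hilbert.

(** * Synthesis operators *)

Section Summation.
Context {R : realType} {I : choiceType}.
Implicit Types (a : I -> R) (F G : {fset I}).

Lemma esum_le_fset a (b : R) : (forall i, 0 <= a i) ->
  (\esum_(i in [set: I]) (a i)%:E <= b%:E)%E <-> forall F, \sum_(i <- F) a i <= b.
Proof.
move=> a0; split=> [H F|H].
  rewrite -lee_fin (le_trans _ H) // esum_ge //; exists [set` F].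
    by split => //; exact: finite_fset.
  by rewrite fsbig_finite ?finite_fset //= set_fsetK sumEFin.
apply: ge_ereal_sup => /= _ [X [finX _] <-].
by rewrite fsbig_finite //= sumEFin lee_fin.
Qed.

(** Take [F] whose partial sum is within [e] of the supremum of all partial sums. *)
Lemma sum_fset_tail a (b e : R) : (forall i, 0 <= a i) ->
  (forall F, \sum_(i <- F) a i <= b) -> 0 < e ->
  exists F, forall G, (F `<=` G)%fset ->
    \sum_(i <- [fset x in G | x \notin F]%fset) a i < e.
Proof.
move=> a0 ab e0; pose A := [set \sum_(i <- F) a i | F in [set: {fset I}]].
have sA : has_sup A.
  split; first by exists (\sum_(i <- fset0) a i), fset0.
  by exists b => _ [F _ <-].
have [_ [F _ <-] Fe] := sup_adherent e0 sA.
exists F => G FG.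
have : \sum_(i <- G) a i <= sup A by apply: sup_upper_bound => //; exists G.
rewrite (big_fsetID _ (mem F)) /=.
have -> : [fset x in G | x \in F]%fset = F.
  by apply/fsetP => x; rewrite !inE; apply: andb_idl; exact: (fsubsetP FG).
by lra.
Qed.

End Summation.

#[local] Existing Instance summability.totally_filter.

Section Families.
Context {R : realType} {K : kreinSpace R} {I : choiceType}.
Implicit Types (W : I -> set K) (v : I -> R) (x y : I -> K) (F : {fset I}).

Lemma Bessel_fset W v : Bessel W v <->
  exists2 B : R, 0 < B & forall f F,
    \sum_(i <- F) v i ^+ 2 * jnorm (jproj (W i) f) ^+ 2 <= B * jnorm f ^+ 2.
Proof.
have a0 f i : 0 <= v i ^+ 2 * jnorm (jproj (W i) f) ^+ 2 by rewrite mulr_ge0 ?sqr_ge0.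
split=> [[B HB]|[B _ HB]]; last by exists B => f; apply/esum_le_fset.
exists (`|B| + 1); first by rewrite ltr_wpDl.
move=> f F; have /esum_le_fset/(_ F) := HB f => /(_ (a0 f)) H.
rewrite (le_trans H) // ler_wpM2r ?sqr_ge0 //.
by rewrite (le_trans (ler_norm B)) // lerDl.
Qed.

Lemma ell2_sum_fset W x : ell2_sum W x <->
  (forall i, W i (x i)) /\ exists b, forall F, \sum_(i <- F) jnorm (x i) ^+ 2 <= b.
Proof.
have a0 i : 0 <= jnorm (x i) ^+ 2 by rewrite sqr_ge0.
split=> [[Wx H]|[Wx [b H]]]; split=> //.
  exists (fine (\esum_(i in [set: I]) (jnorm (x i) ^+ 2)%:E)).
  apply/esum_le_fset => //; rewrite fineK // ge0_fin_numE // esum_ge0 // => i _.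
  by rewrite lee_fin.
by apply: le_lt_trans (ltry b); apply/esum_le_fset.
Qed.

Lemma ell2_sum_coord_proj A W x : (forall i, W i 0) ->
  ell2_sum W x -> ell2_sum W (coord_proj A x).
Proof.
move=> W0 /ell2_sum_fset[Wx [b Hb]]; apply/ell2_sum_fset; split.
  by move=> i; rewrite /coord_proj /patch; case: ifP.
exists b => F; apply: le_trans (Hb F); apply: ler_sum => i _.
rewrite /coord_proj /patch; case: ifP => // _.
by rewrite jnorm0 expr0n sqr_ge0.
Qed.

Lemma rip_sumr (s : seq I) (h : K) (u : I -> K) :
  rip h (\sum_(i <- s) u i) = \sum_(i <- s) rip h (u i).
Proof. by apply: (big_morph (rip h)) => [f g|]; [exact: ripDr|exact: rip0r]. Qed.

(** Duality: [|s|^2] is the sum of the [v i * rip s (y i)], where only the projection of [s] onto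
    [W i] matters. The inequality of arithmetic and geometric means then brings in the Bessel sum of
    [s], which is absorbed on the left. *)
Lemma synthesis_bound W v (B : R) y F :
  (forall i, closed_subspace (W i)) -> (forall i, 0 <= v i) -> 0 < B ->
  (forall f, \sum_(i <- F) v i ^+ 2 * jnorm (jproj (W i) f) ^+ 2 <= B * jnorm f ^+ 2) ->
  (forall i, W i (y i)) ->
  jnorm (\sum_(i <- F) (v i)%:C *: y i) ^+ 2 <= B * \sum_(i <- F) jnorm (y i) ^+ 2.
Proof.
move=> cW v0 B0 HB Wy; set s := \sum_(i <- F) _.
have H : 2 * B * jnorm s ^+ 2 <= B * jnorm s ^+ 2 + B ^+ 2 * \sum_(i <- F) jnorm (y i) ^+ 2.
  rewrite -{1}rip_norm {2}/s rip_sumr !mulr_sumr.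
  apply: le_trans (lerD (HB s) (lexx _)); rewrite -big_split /=.
  apply: ler_sum => i _; rewrite ripZr.
  have := rip_le_jproj s (cW i) (Wy i).
  move: (rip s _) (jnorm (jproj _ _)) (jnorm (y i)) (v i) (v0 i) => r p n w w0 H.
  have : B * w * r <= B * w * (p * n) by rewrite ler_wpM2l // mulr_ge0 // ltW.
  have := sqr_ge0 (w * p - B * n); nra.
by rewrite -(ler_pM2l B0); nra.
Qed.

Lemma partial_sumE (u : I -> K) F : summability.partial_sum u F = \sum_(i <- F) u i.
Proof. by rewrite /summability.partial_sum big_seq_fsetE. Qed.

Lemma synthesis_cvg W v x :
  (forall i, closed_subspace (W i)) -> (forall i, 0 <= v i) -> Bessel W v ->
  ell2_sum W x ->
  cvg (summability.partial_sum (fun i => (v i)%:C *: x i) @ summability.totally).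
Proof.
move=> cW v0 /Bessel_fset[B B0 HB] /ell2_sum_fset[Wx [b Hb]].
apply: cauchy_cvg; apply: cauchy_exP => e e0.
have eE : e = (complex.Re e)%:C.
  by move: e0; case: (e) => ? ?; rewrite ltcE /= => /andP[/eqP ->].
have e0' : 0 < complex.Re e by rewrite -ltcR -eE.
move: (complex.Re e) eE e0' => r -> {e0 e} r0.
(* By [synthesis_bound], a tail of squared norms below [r ^+ 2 / B] synthesises to a vector shorter
   than [r]. *)
have [||F HF] := @sum_fset_tail _ _ (fun i => jnorm (x i) ^+ 2) b (r ^+ 2 / B) _ Hb.
  by move=> i; rewrite sqr_ge0.
  by rewrite divr_gt0 ?exprn_gt0.
exists (\sum_(i <- F) (v i)%:C *: x i); exists F => // G /= FG.
rewrite -ball_normE /ball_ /= normKE ltcR partial_sumE jnormB.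
rewrite [X in X - _](big_fsetID _ (mem F)) /=.
have -> : [fset x in G | x \in F]%fset = F.
  by apply/fsetP => z; rewrite !inE; apply: andb_idl; exact: (fsubsetP FG).
rewrite addrAC subrr add0r -(@ltr_pXn2r _ 2) ?nnegrE ?jnorm_ge0 ?ltW //.
apply: le_lt_trans (synthesis_bound cW v0 B0 (fun f => HB f _) Wx) _.
by rewrite mulrC -ltr_pdivlMr // HF.
Qed.

Lemma synthesis_linear W v x (T : {linear K -> K}) (M : R) :
  (forall i, closed_subspace (W i)) -> (forall i, 0 <= v i) -> Bessel W v ->
  (forall f, jnorm (T f) <= M * jnorm f) -> ell2_sum W x ->
  synthesis v (fun i => T (x i)) = T (synthesis v x).
Proof.
move=> cW v0 BW TM Wx; have := synthesis_cvg cW v0 BW Wx.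
move=> /cvgrPdist_lt Hx.
apply: cvg_lim; first exact: norm_hausdorff.
apply/cvgrPdist_lt => e e0.
have eE : e = (complex.Re e)%:C.
  by move: e0; case: (e) => ? ?; rewrite ltcE /= => /andP[/eqP ->].
have e0' : 0 < complex.Re e by rewrite -ltcR -eE.
move: (complex.Re e) eE e0' => r -> {e0 e} r0.
have M1 : 0 < `|M| + 1 by rewrite ltr_wpDl.
have := Hx (r / (`|M| + 1))%:C; rewrite ltcR divr_gt0 // => /(_ isT).
apply: filterS => F; rewrite !normKE !ltcR ltr_pdivlMr // !partial_sumE => H.
have -> : \sum_(i <- F) (v i)%:C *: T (x i) = T (\sum_(i <- F) (v i)%:C *: x i).
  by rewrite linear_sum; apply: eq_bigr => i _; rewrite linearZ.
rewrite -linearB (le_lt_trans (TM _)) // (le_lt_trans _ H) // mulrC ler_wpM2l ?jnorm_ge0 //.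
by rewrite (le_trans (ler_norm M)) // lerDl.
Qed.

Lemma synthesis0 v x : (forall i, x i = 0) -> synthesis v x = 0.
Proof.
move=> x0; apply: cvg_lim; first exact: norm_hausdorff.
rewrite (_ : summability.partial_sum _ = cst 0); first exact: cvg_cst.
by apply/funext => F; rewrite partial_sumE big1 // => i _; rewrite x0 scaler0.
Qed.

End Families.

(** * Indefinite spaces *)

Section Definite.
Context {R : realType} {K : kreinSpace R}.
Implicit Types (f g h x y z : K) (a b c t s : R) (V : set K).

(** The values [s = 1] and [s = -1] let one argument serve both signs. *)
Definition unif_sign s V := exists2 al : R, 0 < al &
  forall f, V f -> al * jnorm f ^+ 2 <= s * qf f.

Lemma unif_JposE V : unif_Jpos V <-> unif_sign 1 V.
Proof.
by split=> -[al al0 H]; exists al => // f /H; rewrite mul1r kform_qf lecR.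
Qed.

Lemma unif_JnegE V : unif_Jneg V <-> unif_sign (-1) V.
Proof.
by split=> -[al al0 H]; exists al => // f /H; rewrite mulN1r kform_qf -rmorphN lecR.
Qed.

Lemma rip_ir f g : rip f ('i%C *: g) = - rip ('i%C *: f) g.
Proof.
rewrite -rip_ii scalerA; have -> : 'i%C * 'i%C = (-1)%:C :> R[i] by rewrite -expr2 sqr_i rmorphN rmorph1.
by rewrite ripZr mulN1r.
Qed.

Lemma rip_if f : rip f ('i%C *: f) = 0.
Proof. by have := rip_ir f f; rewrite (ripC ('i%C *: f)) => H; lra. Qed.

Lemma qf_i f : qf ('i%C *: f) = qf f.
Proof. by rewrite !qf_jdot linearZ rip_ii. Qed.

Lemma qb_if f : qb f ('i%C *: f) = 0.
Proof.
have H : qb f ('i%C *: f) = rip (ksym K f) ('i%C *: f) by rewrite ripE ksymK.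
have := rip_ir (ksym K f) f; rewrite -linearZ -H ripE ksymK qbC => E; lra.
Qed.

(* The complex line through x, as a double orthogonal complement, so that it is
   visibly closed; rip is only the real part of the inner product. *)
Definition complex_line x : set K :=
  [set f | forall z, rip x z = 0 -> rip x ('i%C *: z) = 0 -> rip f z = 0].

Lemma complex_line_id x : complex_line x x. Proof. by []. Qed.

Lemma complex_line_closed x : closed_subspace (complex_line x).
Proof.
split; first split.
- by move=> z _ _; rewrite rip0l.
- move=> c f g Hf Hg z xz xiz; rewrite ripDl Hg // addr0.
  have -> : c *: f = (complex.Re c)%:C *: f + (complex.Im c)%:C *: ('i%C *: f).
    by rewrite scalerA -scalerDl mulrC -complexE.
  rewrite ripDl !ripZl Hf // mulr0 add0r.
  have := rip_ir f z; rewrite Hf //; first by move/esym/eqP; rewrite oppr_eq0 => /eqP ->; rewrite mulr0.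
  rewrite scalerA; have -> : 'i%C * 'i%C = (-1)%:C :> R[i] by rewrite -expr2 sqr_i rmorphN rmorph1.
  by rewrite ripZr xz mulr0.
apply/closedP => l Hl z xz xiz; apply/eqP; rewrite -normr_le0; apply/ler_addgt0Pl => e e0.
have n0 : 0 < jnorm z + 1 by rewrite ltr_wpDl ?jnorm_ge0.
have [|u Hu] := Hl (e / (jnorm z + 1)); first by rewrite divr_gt0.
rewrite ltr_pdivlMr // => lu; have := rip_le_abs (l - u) z.
rewrite ripDl ripNl Hu // oppr0 !addr0; have := jnorm_ge0 (l - u); nra.
Qed.

(** Subtracting from [f] its components along [x] and ['i *: x] leaves a [z] orthogonal to both; by
    definition of the line [f] is orthogonal to [z], hence [z = 0]. *)
Lemma complex_lineP x f : x != 0 -> complex_line x f ->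
  exists a b, f = a%:C *: x + b%:C *: ('i%C *: x).
Proof.
move=> x0 Hf; have nx : jnorm x ^+ 2 != 0 by rewrite sqrf_eq0 gt_eqF ?jnorm_gt0.
pose a := rip f x / jnorm x ^+ 2; pose b := rip f ('i%C *: x) / jnorm x ^+ 2.
exists a, b; pose z := f - (a%:C *: x + b%:C *: ('i%C *: x)).
have xz : rip x z = 0.
  rewrite /z ripDr ripNr ripDr !ripZr rip_if mulr0 addr0 rip_norm divfK // ripC subrr //.
have ixz : rip ('i%C *: x) z = 0.
  rewrite /z ripDr ripNr ripDr !ripZr (ripC _ x) rip_if mulr0 add0r rip_ii rip_norm divfK //.
  by rewrite ripC subrr.
have fz : rip f z = 0 by apply: Hf => //; rewrite rip_ir ixz oppr0.
apply/eqP; rewrite -subr_eq0 -/z; apply/eqP/jnorm_eq0/eqP.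
by rewrite -sqrf_eq0 -rip_norm {1}/z ripDl ripNl ripDl !ripZl fz xz ixz; apply/eqP; ring.
Qed.

(** At [a x + b i x] both [qf] and the squared norm are [a^2 + b^2] times their value at [x], so
    their quotient is constant. Preservation of definiteness thereby becomes an estimate at a single
    vector. *)
Lemma complex_line_unif s x : 0 < s * qf x -> unif_sign s (complex_line x).
Proof.
move=> sx; have x0 : x != 0 by apply: contraTneq sx => ->; rewrite qf0 mulr0 ltxx.
have nx : 0 < jnorm x ^+ 2 by rewrite exprn_gt0 ?jnorm_gt0.
exists (s * qf x / jnorm x ^+ 2); first by rewrite divr_gt0.
move=> f /(complex_lineP x0)[a [b ->]].
rewrite rip_sqrD !jnormZ ripZl ripZr rip_if qfD !qfZ qbZl qbZr qb_if qf_i !exprMn.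
have -> : jnorm ('i%C *: x) ^+ 2 = jnorm x ^+ 2 by rewrite -!rip_norm rip_ii.
rewrite !real_normK ?num_real // le_eqVlt; apply/orP; left; apply/eqP.
by field; rewrite -sqrf_eq0 gt_eqF.
Qed.

Lemma quad_pos a b c : 0 < a -> exists2 t, 0 < t & 0 < a + 2 * t * b + t ^+ 2 * c.
Proof.
(* With [t = a / D <= 1], the perturbation is at most [t (2 |b| + |c|) = a - t (a + 1)], hence less
   than [a]. *)
move=> a0; pose D := 2 * `|b| + `|c| + a + 1.
have D0 : 0 < D by rewrite /D; have := normr_ge0 b; have := normr_ge0 c; lra.
have tD : a / D * D = a by rewrite divfK // gt_eqF.
have t0 : 0 < a / D by rewrite divr_gt0.
have t1 : a / D <= 1.
  by rewrite ler_pdivrMr // mul1r /D; have := normr_ge0 b; have := normr_ge0 c; lra.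
exists (a / D) => //; move: (a / D) tD t0 t1 => t; rewrite /D => tD t0 t1.
have b1 := ler_norm (- b); have c1 := ler_norm (- c); rewrite !normrN in b1 c1.
have : - (t * `|b|) <= t * b by nra.
have : 0 <= t * (1 - t) * `|c| by rewrite !mulr_ge0 // ?subr_ge0 // ltW.
have : 0 <= t ^+ 2 * (`|c| + c) by rewrite mulr_ge0 ?sqr_ge0 //; lra.
by nra.
Qed.

Lemma quad_limit a b c :
  (forall t, 0 < t -> 0 <= a + 2 * t * b + t ^+ 2 * c) -> 0 <= a.
Proof.
move=> H; rewrite leNgt; apply/negP => a0.
have [|t t0 Ht] := @quad_pos (- a) (- b) (- c); first by rewrite oppr_gt0.
by have := H _ t0; nra.
Qed.

End Definite.

(** * Injectivity of the operator and scaling of an indefinite form *)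

Section Indefinite.
Context {R : realType} {K : kreinSpace R}.
Implicit Types (f g h x y z : K) (a b c t s : R) (V : set K).
Variables (T : {linear K -> K}) (M : R).
Hypothesis TM : forall f, jnorm (T f) <= M * jnorm f.
Hypothesis Tsurj : forall y, exists x, T x = y.
Hypothesis Tsign : forall s x, s = 1 \/ s = -1 -> 0 < s * qf x ->
  exists2 al : R, 0 < al & al * jnorm (T x) ^+ 2 <= s * qf (T x).
Hypothesis indef : forall s, s = 1 \/ s = -1 -> exists x, 0 < s * qf x.

Lemma sign_cases s : s = 1 \/ s = -1 -> - s = 1 \/ - s = -1.
Proof. by case=> ->; [right|left; rewrite opprK]. Qed.

Let TZ a x : T (a%:C *: x) = a%:C *: T x. Proof. exact: linearZ. Qed.

(** For small [t > 0] the vector [f + t h] keeps the sign of [f], and its image is [t T h]. *)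
Lemma ker_semidefinite s f h : s = 1 \/ s = -1 -> T f = 0 ->
  0 < s * qf f -> 0 <= s * qf (T h).
Proof.
move=> ss Tf fp; have [t t0 Ht] := quad_pos (s * qb f h) (s * qf h) fp.
have [|al al0] := Tsign (x := f + t%:C *: h) ss.
  by rewrite qfD qbZr qfZ; nra.
rewrite linearD Tf add0r TZ jnormZ exprMn qfZ real_normK ?num_real // => H.
have t2 : 0 < t ^+ 2 by rewrite exprn_gt0.
have := sqr_ge0 (jnorm (T h)); move: (jnorm _ ^+ 2) H => n H n0.
have : 0 <= al * (t ^+ 2 * n) by rewrite mulr_ge0 ?(ltW al0) // mulr_ge0 // ltW.
by move/le_trans/(_ H); rewrite mulrCA pmulr_rge0.
Qed.

(** For small [t > 0], [f + t h] is positive and [f - t h] negative, while their images are [t T h]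
    and [- t T h]; so [qf (T h)] is bounded below by a positive, and above by a negative, multiple
    of [|T h|^2]. *)
Lemma ker_neutral f h : T f = 0 -> qf f = 0 -> 0 < qb f h -> T h = 0.
Proof.
move=> Tf f0 b0; pose t := qb f h / (`|qf h| + 1).
have n0 : 0 < `|qf h| + 1 by rewrite ltr_wpDl.
have t0 : 0 < t by rewrite divr_gt0.
have tE : t * (`|qf h| + 1) = qb f h by rewrite divfK // gt_eqF.
have [p1 p2] : t * qf h <= qb f h /\ - (t * qf h) <= qb f h.
  have := ler_norm (qf h); have := ler_norm (- qf h); rewrite normrN => ? ?; split; nra.
have [||al al0] := Tsign (s := 1) (x := f + t%:C *: h); first by left.
  by rewrite qfD qbZr qfZ f0; nra.
have [||be be0] := Tsign (s := -1) (x := f + (- t)%:C *: h); first by right.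
  by rewrite qfD qbZr qfZ f0; nra.
rewrite !linearD Tf !add0r !TZ !jnormZ !exprMn !qfZ normrN sqrrN real_normK ?num_real // => H1 H2.
have t2 : 0 < t ^+ 2 by rewrite exprn_gt0.
apply/jnorm_eq0/eqP; rewrite -sqrf_eq0 eq_le sqr_ge0 andbT.
have H : (al + be) * (t ^+ 2 * jnorm (T h) ^+ 2) <= 0 by nra.
by move: H; rewrite pmulr_rle0 ?addr_gt0 // pmulr_rle0.
Qed.

(** A definite kernel vector would make the form semidefinite on the range of [T], so [f] is
    neutral. If it were nonzero, [ksym K f] would pair positively with it, and [ker_neutral] applied
    to [h], [- h] or [h + ksym K f] would make [T] vanish identically. *)
Lemma T_injective0 f : T f = 0 -> f = 0.
Proof.
move=> Tf; apply/eqP; apply/negPn/negP => f0.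
have nonsign s : s = 1 \/ s = -1 -> ~ (0 < s * qf f).
  move=> ss fp; have [y yp] := indef (sign_cases ss); have [x xy] := Tsurj y.
  by have := ker_semidefinite x ss Tf fp; rewrite xy; nra.
have fq0 : qf f = 0.
  have := nonsign 1 (or_introl erefl); have := nonsign (-1) (or_intror erefl).
  by case: (ltrgt0P (qf f)) => // ? H1 H2; [case: H2|case: H1]; lra.
have Jf : 0 < qb f (ksym K f) by rewrite qbC -ripE rip_norm exprn_gt0 ?jnorm_gt0.
have T0 h : T h = 0.
  have [hp|hn|h0] := ltrgt0P (qb f h).
  - exact: ker_neutral hp.
  - have := @ker_neutral f ((-1)%:C *: h) Tf fq0; rewrite qbZr TZ => H.
    have /H : 0 < -1 * qb f h by lra.
    by rewrite -scaleN1c => /eqP; rewrite oppr_eq0 => /eqP.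
  - have := @ker_neutral f (h + ksym K f) Tf fq0; rewrite qbC qbDl !(qbC _ f) h0 add0r linearD.
    by rewrite (ker_neutral Tf fq0 Jf) addr0; apply.
have [y yp] := indef (or_introl erefl); have [x xy] := Tsurj y.
by move: yp; rewrite -xy T0 qf0 mulr0 ltxx.
Qed.

Lemma T_pos s x : s = 1 \/ s = -1 -> 0 < s * qf x -> 0 < s * qf (T x).
Proof.
move=> ss xp; have [al al0 H] := Tsign ss xp; apply: lt_le_trans H.
rewrite mulr_gt0 // exprn_gt0 // jnorm_gt0 //; apply: contraTneq xp => /T_injective0 ->.
by rewrite qf0 mulr0 ltxx.
Qed.

(** [z] is the limit of the vectors [z + t p] of sign [s], where the sign of [p] is adjusted so that
    the cross term does not hurt. *)
Lemma T_neutral_sign s z : s = 1 \/ s = -1 -> qf z = 0 -> 0 <= s * qf (T z).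
Proof.
move=> ss z0; have [p0 pp0] := indef ss.
have [p pp zp] : exists2 p, 0 < s * qf p & 0 <= s * qb z p.
  have [zp|zp] := leP 0 (s * qb z p0); first by exists p0.
  exists ((-1)%:C *: p0); first by rewrite qfZ sqrrN expr1n mul1r.
  by rewrite qbZr; lra.
apply: (@quad_limit _ _ (s * qb (T z) (T p)) (s * qf (T p))) => t t0.
have : 0 < s * qf (z + t%:C *: p).
  rewrite qfD qbZr qfZ z0.
  have h1 : 0 <= t * (s * qb z p) by rewrite mulr_ge0 // ltW.
  have h2 : 0 < t ^+ 2 * (s * qf p) by rewrite mulr_gt0 // exprn_gt0.
  lra.
by move/(T_pos ss); rewrite linearD TZ qfD qbZr qfZ => H; lra.
Qed.

Lemma T_neutral z : qf z = 0 -> qf (T z) = 0.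
Proof.
move=> z0; have := T_neutral_sign (or_introl erefl) z0.
have := T_neutral_sign (or_intror erefl) z0; lra.
Qed.

Lemma T_ratio x y : 0 < qf x -> qf y < 0 -> qf (T x) * qf y = qf x * qf (T y).
Proof.
move=> xp yn; set a := qf x in xp *; set d := qf y in yn *; set b := qb x y.
(* A quarter of the discriminant of [t |-> qf (x + t y)], positive because [a] and [d] have opposite
   signs. *)
have D0 : 0 < b ^+ 2 - a * d by have := sqr_ge0 b; nra.
set r := Num.sqrt (b ^+ 2 - a * d).
have r0 : 0 < r by rewrite sqrtr_gt0.
have rE : r ^+ 2 = b ^+ 2 - a * d by rewrite sqr_sqrtr // ltW.
have d0 : d != 0 by rewrite lt_eqF.
(* For [u = r] or [u = - r], the neutral vector [d x + (u - b) y] is a root cleared of its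
   denominator [d]; [T] keeps it neutral. *)
have root u : u ^+ 2 = r ^+ 2 ->
    qf (T x) * d ^+ 2 + 2 * d * (u - b) * qb (T x) (T y) + (u - b) ^+ 2 * qf (T y) = 0.
  move=> uE; have /T_neutral : qf (d%:C *: x + (u - b)%:C *: y) = 0.
    rewrite qfD !qfZ qbZl qbZr -/a -/b -/d.
    by apply/eqP; rewrite -(mulrI_eq0 _ (mulfI d0)); apply/eqP; move: uE rE; nra.
  by rewrite linearD !TZ qfD !qfZ qbZl qbZr => <-; ring.
have H1 := root r erefl; have H2 := root (- r) (sqrrN r).
(* The difference of the two relations determines [qb (T x) (T y)]; their sum then gives the
   ratio. *)
have E1 : r * (d * qb (T x) (T y) - b * qf (T y)) = 0 by nra.
have E2 : d * qb (T x) (T y) = b * qf (T y).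
  by apply/eqP; rewrite -subr_eq0 -(mulrI_eq0 _ (mulfI (lt0r_neq0 r0))) E1.
apply: (mulfI d0); move: H1 H2 rE E2; move: (qf (T x)) (qf (T y)) (qb (T x) (T y)) => a' d' b'.
move=> H1 H2 rE E2.
have : a' * d ^+ 2 - 2 * b * (d * b') + (r ^+ 2 + b ^+ 2) * d' = 0 by nra.
by rewrite E2 rE => ?; nra.
Qed.

(** The constant is read off at one positive [p]. [T_ratio] carries it to all negative vectors and
    from a negative [n] to all positive ones. *)
Lemma T_scaling : exists2 c, 0 < c & forall x, qf (T x) = c * qf x.
Proof.
have [p pp] := indef (or_introl erefl); have [n nn] := indef (or_intror erefl).
rewrite mul1r in pp; have {}nn : qf n < 0 by lra.
have Tp := T_pos (or_introl erefl) (x := p); rewrite !mul1r in Tp.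
have {}Tp := Tp pp.
exists (qf (T p) / qf p); first by rewrite divr_gt0.
have p0 : qf p != 0 by rewrite gt_eqF.
have n0 : qf n != 0 by rewrite lt_eqF.
have neg y : qf y < 0 -> qf (T y) = qf (T p) / qf p * qf y.
  by move=> yn; apply: (mulfI p0); rewrite mulrA mulrCA -(T_ratio pp yn) divff // mulr1.
move=> x; have [xp|/neg //|x0] := ltrgt0P (qf x); last by rewrite T_neutral // x0 mulr0.
apply: (mulIf n0); rewrite (T_ratio xp nn) (neg _ nn) //; ring.
Qed.

Lemma T_bounded_below : exists2 C : R, 0 < C & forall x, jnorm x <= C * jnorm (T x).
Proof.
have [c c0 cE] := T_scaling; exists ((`|M| + 1) / c).
  by rewrite divr_gt0 // ltr_wpDl.
move=> x; rewrite mulrAC ler_pdivlMr // mulrC.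
have [->|x0] := eqVneq x 0; first by rewrite linear0 !jnorm0 !mulr0.
have n0 := jnorm_gt0 x0.
(* Polarisation of the scaling identity at [ksym K x] and [x], whose product [qb] is [|x|^2]. *)
have H : c * jnorm x ^+ 2 = qb (T (ksym K x)) (T x).
  have := cE (ksym K x + x); have := cE (ksym K x - x).
  rewrite linearB linearD !scaleN1c !qfD !qbZr !qfZ.
  by rewrite -ripE rip_norm => ? ?; lra.
have : qb (T (ksym K x)) (T x) <= (`|M| * jnorm x) * jnorm (T x).
  rewrite -[T (ksym _ _)]ksymK -ripE (le_trans (rip_le _ _)) // jnorm_ksym ler_wpM2r ?jnorm_ge0 //.
  rewrite (le_trans (TM _)) // jnorm_ksym ler_wpM2r ?jnorm_ge0 //; exact: ler_norm.
rewrite -H => H2; rewrite -(ler_pM2l n0).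
by have := jnorm_ge0 (T x); nra.
Qed.

End Indefinite.

(** * Semi-Fredholm estimates on Hilbert spaces *)

Section FredholmBound.
Context {R : realType} {K : kreinSpace R}.
Implicit Types (f g h x y z u w : K) (a b c t : R) (V N : set K) (s : seq K).
Variables (T : {linear K -> K}) (M : R).
Hypothesis M0 : 0 <= M.
Hypothesis TM : forall f, jnorm (T f) <= M * jnorm f.

Lemma rip_ext f g : (forall x, rip f x = rip g x) -> f = g.
Proof.
move=> H; apply/eqP; rewrite -subr_eq0; apply/eqP/jnorm_eq0/eqP.
by rewrite -sqrf_eq0 -rip_norm ripDl ripNl H subrr.
Qed.

Lemma adjoint_exists : exists A : K -> K, forall f x, rip f (T x) = rip (A f) x.
Proof.
suff /choice[A HA] : forall f, exists h, forall x, rip f (T x) = rip h x by exists A.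
move=> f; apply: (@riesz _ _ (fun x => rip f (T x)) (jnorm f * M)).
  by move=> a x y; rewrite linearP ripDr ripZr.
move=> x; rewrite (le_trans (rip_le_abs _ _)) // -mulrA ler_wpM2l ?jnorm_ge0 //.
Qed.

Lemma adjoint_le (A : K -> K) f :
  (forall f x, rip f (T x) = rip (A f) x) -> jnorm (A f) <= M * jnorm f.
Proof.
move=> AE; have [->|n0] := eqVneq (A f) 0; first by rewrite jnorm0 mulr_ge0 // jnorm_ge0.
rewrite -(ler_pM2l (jnorm_gt0 n0)) -expr2 -rip_norm -AE (le_trans (rip_le _ _)) //.
by rewrite mulrCA mulrA mulrC ler_wpM2r ?jnorm_ge0 // mulrC TM.
Qed.

(** With ratio 1/3 the terms after the [n]-th sum to only half of [third n], so in the gliding hump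
    each term dominates its tail. *)
Definition third n : R := 3^-1 ^+ n.

Lemma third_gt0 n : 0 < third n. Proof. by rewrite exprn_gt0 // invr_gt0. Qed.

Lemma thirdS n : 3 * third n.+1 = third n.
Proof. by rewrite /third exprS mulrA divff ?mul1r. Qed.

Lemma third_le m n : (m <= n)%N -> third n <= third m.
Proof. by move=> mn; rewrite /third ler_wiXn2l // ?invr_ge0 // invf_le1 // ler1n. Qed.

Lemma third_lt (e : R) : 0 < e -> exists n : nat, third n < e.
Proof.
move=> /inv_succ_lt[n ne]; exists n; apply: le_lt_trans ne.
rewrite /third exprVn lef_pV2 ?posrE ?exprn_gt0 //.
by rewrite -natrX ler_nat ltn_expl.
Qed.

(** [3 / 2 * third n] is the sum of the geometric tail starting at [third n]. *)
Lemma geometric_limit (u : nat -> K) :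
  (forall n, jnorm (u n.+1 - u n) <= third n) ->
  exists l, forall n, jnorm (u n - l) <= 3 / 2 * third n.
Proof.
move=> Hu; apply: rcomplete => [n m|e e0]; last first.
  have [|n ne] := @third_lt (e / 2); first by rewrite divr_gt0.
  by exists n; lra.
suff H k : jnorm (u n - u (n + k)%N) <= 3 / 2 * (third n - third (n + k)).
  move=> nm; rewrite -(subnKC nm) (le_trans (H _)) //.
  by have := third_gt0 (n + (m - n))%N; lra.
elim: k => [|k IH]; first by rewrite addn0 !subrr jnorm0 mulr0.
rewrite addnS; apply: le_trans (jnormDB _ (u (n + k)%N) _) _.
have := Hu (n + k)%N; have := thirdS (n + k); rewrite jnormB; lra.
Qed.

Section Adjoint.
Variable A : K -> K.
Hypothesis AE : forall f x, rip f (T x) = rip (A f) x.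
Hypothesis Tsurj : forall y, exists x, T x = y.

Lemma adjointP a f g : A (a%:C *: f + g) = a%:C *: A f + A g.
Proof. by apply: rip_ext => x; rewrite -AE ripDl ripZl !AE ripDl ripZl. Qed.

Lemma adjointZ a f : A (a%:C *: f) = a%:C *: A f.
Proof. by apply: rip_ext => x; rewrite -AE !ripZl AE. Qed.

Lemma adjointB f g : A (f - g) = A f - A g.
Proof. by rewrite addrC scaleN1c adjointP -scaleN1c addrC. Qed.

(* Gliding hump: were the bound to fail, suitably signed vectors with
   |A y_n| <= 1 and |y_n| = 2 (n + 1) 3^n would add up to some l = T x with
   |<y_n, l>| >= n + 1, whereas |<y_n, T x>| <= |x|. *)
Lemma adjoint_bounded_below :
  exists2 C : R, 0 < C & forall y, jnorm y <= C * jnorm (A y).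
Proof.
apply: contrapT => H.
(* A vector violating the bound with constant [D], rescaled to norm [D]. *)
have big (D : R) : 0 < D -> exists y, jnorm (A y) <= 1 /\ jnorm y = D.
  move=> D0; apply: contrapT => HD; apply: H; exists D => // y.
  rewrite leNgt; apply/negP => yD; apply: HD.
  have y0 : 0 < jnorm y by apply: le_lt_trans yD; rewrite mulr_ge0 ?jnorm_ge0 // ltW.
  have Dy0 : 0 < D / jnorm y by rewrite divr_gt0.
  exists ((D / jnorm y)%:C *: y); rewrite adjointZ !jnormZ gtr0_norm // divfK ?gt_eqF //.
  by split=> //; rewrite mulrAC ler_pdivrMr // mul1r ltW.
pose D n : R := 2 * n.+1%:R / third n.
have D0 n : 0 < D n by rewrite divr_gt0 ?third_gt0 // mulr_gt0.
have /choice[ys Hys] n := big (D n) (D0 n).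
(* The sign prevents the new term from cancelling against [rip (ys n) z]. *)
pose sg n z : R := if 0 <= rip (ys n) z then 1 else -1.
pose fix zs n := if n is k.+1
  then zs k + (sg k (zs k) * third k / D k)%:C *: ys k else 0.
have [|l Hl] := @geometric_limit zs.
  move=> n /=; rewrite addrAC subrr add0r jnormZ (proj2 (Hys n)).
  rewrite normrM normfV (gtr0_norm (D0 n)) divfK ?gt_eqF // normrM (gtr0_norm (third_gt0 n)).
  by rewrite /sg; case: ifP => _; rewrite ?normrN normr1 mul1r.
have [x xl] := Tsurj l.
have bound n : n.+1%:R <= jnorm x.
  have [A1 yD] := Hys n; have := rip_le_abs (A (ys n)) x; rewrite -AE xl => Hx.
  have {Hx} Hx : `|rip (ys n) l| <= jnorm x.
    by rewrite (le_trans Hx) // -[leRHS]mul1r ler_wpM2r ?jnorm_ge0.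
  have := Hl n.+1; have := rip_le_abs (ys n) (zs n.+1 - l); rewrite ripDr ripNr /=.
  rewrite ripDr ripZr rip_norm yD expr2 mulrA divfK ?gt_eqF //.
  have := thirdS n; have t0 := third_gt0 n; have : D n * third n = 2 * n.+1%:R by rewrite /D divfK // gt_eqF.
  rewrite -[zs n + _]/(zs n.+1).
  set p := jnorm (_ - l); set q := rip _ (zs n); move: Hx; set r := rip _ l.
  move=> Hx Dt t3 Hr Hp.
  (* The later terms cost at most half of the contribution [D n * third n = 2 (n + 1)] of the [n]-th
     one. *)
  have Dp : D n * p <= n.+1%:R.
    have : D n * p <= D n * (3 / 2 * third n.+1) by rewrite ler_pM2l.
    have -> : D n * (3 / 2 * third n.+1) = D n * third n / 2 by rewrite -t3; field.
    lra.
  have := ler_norm r; have := ler_norm (- r); rewrite normrN => r1 r2.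
  move: Hr; rewrite ler_norml => /andP[].
  rewrite /sg -/q; case: (leP 0 q) => q0; lra.
by have := bound (Num.truncn (jnorm x)); rewrite leNgt truncnS_gt.
Qed.

(** Being bounded below, [A] has closed range, and the part of [x] orthogonal to this range lies in
    the kernel of [T], hence vanishes. So [x = A y] and [|x|^2 = rip y (T x) <= C |x| |T x|]. *)
Lemma coercive_on_kernel_orth : exists2 C : R, 0 < C &
  forall x, (forall n, T n = 0 -> rip x n = 0) -> jnorm x <= C * jnorm (T x).
Proof.
have [C C0 AC] := adjoint_bounded_below; exists C => // x xN.
pose V := range A.
have A0 : A 0 = 0 by apply: rip_ext => z; rewrite -AE !rip0l.
have sV : rsubspace V.
  split; first by exists 0.
  by move=> a _ _ [f _ <-] [g _ <-]; exists (a%:C *: f + g) => //; rewrite adjointP.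
have cV : closed V.
  apply/closedP => l Hl.
  have /choice[ys Hys] n : exists y, jnorm (l - A y) < third n / C.
    by have [|_ [y _ <-] ?] := Hl (third n / C); [rewrite divr_gt0 ?third_gt0|exists y].
  have [n m nm|e e0|y Hy] := @rcomplete _ _ ys (fun n => 2 * third n).
  - apply: le_trans (AC _) _; rewrite adjointB.
    have := jnormDB (A (ys n)) l (A (ys m)); rewrite (jnormB _ l) -(ler_pM2l C0) => h1.
    have := Hys n; have := Hys m; rewrite !ltr_pdivlMr // => h2 h3.
    have h4 := third_le nm.
    lra.
  - by have [|n ne] := @third_lt (e / 2); [rewrite divr_gt0|exists n; lra].
  exists y => //; apply/eqP; rewrite -subr_eq0; apply/eqP/jnorm_eq0/eqP.
  rewrite eq_le jnorm_ge0 andbT; apply/ler_addgt0Pl => e e0; rewrite addr0.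
  have P0 : 0 < 2 * M + C^-1 by rewrite ltr_wpDl ?invr_gt0 // mulr_ge0.
  have [|n ne] := @third_lt (e / (2 * M + C^-1)); first by rewrite divr_gt0.
  rewrite ltr_pdivlMr // in ne.
  apply: le_trans (jnormDB _ (A (ys n)) _) _; rewrite -adjointB (jnormB _ l).
  have h1 := adjoint_le (y - ys n) AE; have h2 := Hys n; have h3 := Hy n.
  rewrite jnormB in h3; have h4 := ler_wpM2l M0 h3; lra.
have [_ [y _ <-] Hp] := rproj_exists x sV cV.
set r := x - A y in Hp.
have Tr : T r = 0.
  by apply: rip_ext => z; rewrite rip0l ripC AE ripC Hp //; exists z.
have r0 : x = A y.
  apply/eqP; rewrite -subr_eq0 -/r; apply/eqP/jnorm_eq0/eqP.
  rewrite -sqrf_eq0 -rip_norm {1}/r ripDl ripNl xN // -AE Tr rip0r subrr //.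
have [->|n0] := eqVneq x 0; first by rewrite linear0 jnorm0 mulr0.
rewrite -(ler_pM2l (jnorm_gt0 n0)) -expr2 -rip_norm {1}r0 -AE.
rewrite (le_trans (rip_le _ _)) // mulrA ler_wpM2r ?jnorm_ge0 //.
by rewrite mulrC r0 AC.
Qed.

End Adjoint.
End FredholmBound.

(** * Finite orthonormal expansions *)

Section Orthonormal.
Context {R : realType} {K : kreinSpace R}.
Implicit Types (f g h x y z u w : K) (a b c t : R) (V N : set K) (s : seq K).

(* Orthonormality for the real inner product rip. *)
Fixpoint orthonormals s : Prop := if s is u :: s'
  then [/\ rip u u = 1, forall e, e \in s' -> rip u e = 0 & orthonormals s'] else True.

(** [r] is [w] minus its projection onto the real span of [s]. The last clause places [w - r] in
    that span by orthogonality; the induction uses it to get [rip r u = rip w u]. *)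
Lemma orthonormals_expand N s w : rsubspace N -> (forall e, e \in s -> N e) ->
  orthonormals s -> exists r, [/\ N (w - r), forall e, e \in s -> rip r e = 0,
    jnorm w ^+ 2 = jnorm r ^+ 2 + \sum_(e <- s) rip w e ^+ 2 &
    forall z, (forall e, e \in s -> rip e z = 0) -> rip (w - r) z = 0].
Proof.
move=> [N0 ND]; elim: s => [|u s IH] sN /=.
  by move=> _; exists w; split=> [||| z _] //; rewrite ?subrr ?big_nil ?addr0 ?rip0l.
move=> [uu us /IH[|r [rN rs rE rz]]]; first by move=> e es; apply: sN; rewrite inE es orbT.
have wu : rip r u = rip w u.
  have : rip (w - r) u = 0 by apply: rz => e es; rewrite ripC us.
  by rewrite ripDl ripNl => ?; lra.
have E : w - (r - (rip r u)%:C *: u) = (rip r u)%:C *: u + (w - r).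
  by rewrite opprB addrCA.
exists (r - (rip r u)%:C *: u); split.
- by rewrite E; apply: ND => //; apply: sN; rewrite inE eqxx.
- move=> e; rewrite inE ripDl ripNl ripZl => /orP[/eqP ->|es]; first by rewrite uu mulr1 subrr.
  by rewrite rs // us // mulr0 subrr.
- rewrite big_cons rip_sqrB ripZr jnormZ -wu rE exprMn -(rip_norm u) uu real_normK ?num_real //.
  ring.
- move=> z Hz; rewrite E ripDl ripZl Hz ?inE ?eqxx // mulr0 add0r rz // => e es.
  by apply: Hz; rewrite inE es orbT.
Qed.

Lemma subspace_imaginary V : V 0 -> (forall a f g, V f -> V g -> V (a%:C *: f + g)) ->
  (forall f, V f -> V ('i%C *: f)) -> subspace V.
Proof.
move=> V0 VD Vi; split=> // c f g Vf Vg.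
have -> : c *: f + g = (complex.Re c)%:C *: f + ((complex.Im c)%:C *: ('i%C *: f) + g).
  by rewrite addrA scalerA -scalerDl mulrC -complexE.
by apply: (VD) => //; apply: VD => //; apply: Vi.
Qed.

End Orthonormal.

(** * Finite-dimensionality of the kernel *)

Section Kernel.
Context {R : realType} {K : kreinSpace R}.
Implicit Types (f g h x y z u w : K) (a b c t : R) (V N : set K) (s : seq K).
Variables (T : {linear K -> K}) (M : R).
Hypothesis M0 : 0 <= M.
Hypothesis TM : forall f, jnorm (T f) <= M * jnorm f.
Hypothesis Tsurj : forall y, exists x, T x = y.
Hypothesis Tclosed : forall V, closed_subspace V -> closed_subspace (T @` V).

Lemma ker_closed_subspace : closed_subspace [set x | T x = 0].
Proof.
split; first by split=> [|c f g /= Tf Tg]; rewrite /= ?linear0 // linearP Tf Tg scaler0 addr0.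
apply/closedP => l Hl; apply/jnorm_eq0/eqP; rewrite eq_le jnorm_ge0 andbT.
apply/ler_addgt0Pl => e e0; have M1 : 0 < M + 1 by rewrite ltr_wpDl.
have [|u /= u0] := Hl (e / (M + 1)); first by rewrite divr_gt0.
rewrite ltr_pdivlMr // addr0 => lu; have := TM (l - u); rewrite linearB u0 subr0.
have := jnorm_ge0 (l - u); lra.
Qed.

Lemma preimage_kernel_orth y :
  exists2 x, T x = y & forall n, T n = 0 -> rip x n = 0.
Proof.
have [x xy] := Tsurj y; have [sN cN] := ker_closed_subspace.
have [p /= Tp Hp] := rproj_exists x (subspace_rsubspace sN) cN.
by exists (x - p); [rewrite linearB Tp subr0|exact: Hp].
Qed.

Section NoInfiniteSequence.
Variable e : nat -> K.
Hypothesis Te : forall n, T (e n) = 0.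
Hypothesis eE : forall m n, rip (e m) (e n) = (m == n)%:R.
Hypothesis eiE : forall m n, rip (e m) ('i%C *: e n) = 0.

(** The two real identities together state the complex relation between the coefficients of [T v]
    and [v], which makes [V] a complex subspace. *)
Let V : set K := [set v | forall n,
  rip (T v) (e n) = third n * rip v (e n) /\
  rip (T v) ('i%C *: e n) = third n * rip v ('i%C *: e n)].

Lemma V_closed_subspace : closed_subspace V.
Proof.
split.
  apply: subspace_imaginary.
  - by move=> n; rewrite linear0 !rip0l !mulr0.
  - move=> a f g Vf Vg n; have [f1 f2] := Vf n; have [g1 g2] := Vg n.
    by rewrite linearP !ripDl !ripZl f1 f2 g1 g2; split; ring.
  - move=> f Vf n; have [f1 f2] := Vf n; have L : T ('i%C *: f) = 'i%C *: T f by rewrite linearZ.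
    rewrite L !rip_ii f1; split=> //.
    by have := rip_ir (T f) (e n); have := rip_ir f (e n); rewrite f2 => -> H; lra.
apply/closedP => l Hl n.
suff H g : (forall u, V u -> rip (T u) g = third n * rip u g) -> rip (T l) g = third n * rip l g.
  by split; apply: H => u /(_ n)[].
move=> Hg; apply/eqP; rewrite -subr_eq0 -normr_le0; apply/ler_addgt0Pl => d d0.
have C1 : 0 < (M + third n) * jnorm g + 1.
  by rewrite ltr_wpDl // mulr_ge0 ?jnorm_ge0 // addr_ge0 // ltW // third_gt0.
have [|u Vu] := Hl (d / ((M + third n) * jnorm g + 1)); first by rewrite divr_gt0.
rewrite ltr_pdivlMr // addr0 => lu.
have -> : rip (T l) g - third n * rip l g = rip (T (l - u)) g - third n * rip (l - u) g.
  by rewrite linearB !ripDl !ripNl (Hg u Vu); ring.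
apply: le_trans (ler_normB _ _) _; rewrite normrM (gtr0_norm (third_gt0 n)).
have h1 := rip_le_abs (T (l - u)) g; have h2 := rip_le_abs (l - u) g.
have h3 := TM (l - u); have g0 := jnorm_ge0 g; have t0 : 0 < third n :> R := third_gt0 n.
have h4 := ler_wpM2r g0 h3; have h5 := ler_wpM2l (ltW t0) h2; have := jnorm_ge0 (l - u); lra.
Qed.

(* T maps V onto a space containing every 3^-n e_n but not their sum: a
   preimage v of the sum in V would satisfy <v, e_n> = 1 for all n. *)
Lemma kernel_sequence_absurd :
  (forall v, exists n, rip v (e n) != 1) -> False.
Proof.
move=> Bess.
have /choice[x Hx] n : exists x, T x = e n /\ forall n, T n = 0 -> rip x n = 0.
  by have [x ? ?] := preimage_kernel_orth (e n); exists x.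
have Ti n : T ('i%C *: e n) = 0 by rewrite linearZ /= Te scaler0.
(* As [x n] is orthogonal to the kernel, [v n] has the same coefficients as [e n], whereas its image
   is [third n] times [e n]; this is membership in [V]. *)
pose v n := e n + (third n)%:C *: x n.
have Tv n : T (v n) = (third n)%:C *: e n.
  by rewrite /v linearD linearZ Te add0r (proj1 (Hx n)).
have Vv n : V (v n).
  move=> m; rewrite Tv /v !ripDl !ripZl !(proj2 (Hx n)) // eE eiE !mulr0 !addr0 mulr0; split=> //.
  by case: eqVneq => [->|]; rewrite ?mulr0.
pose fix w n := if n is k.+1 then v k + w k else 0.
have [sV cV] := V_closed_subspace.
have Vw n : V (w n).
  elim: n => [|n IH] /=; first by case: sV.
  by rewrite -[v n]scale1r; apply: (proj2 sV).
have [|y Hy] := @geometric_limit _ _ (fun n => T (w n)).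
  move=> n /=; rewrite linearD addrK Tv jnormZ gtr0_norm ?third_gt0 //.
  have -> : jnorm (e n) = 1.
    by apply/eqP; rewrite -(@eqrXn2 _ 2) ?jnorm_ge0 // -rip_norm eE eqxx expr1n.
  by rewrite mulr1.
have [_ /closedP cTV] := Tclosed (conj sV cV).
have [d d0|u Vu uy] := cTV y.
  have [|n nd] := @third_lt _ (d / 2); first by rewrite divr_gt0.
  exists (T (w n)); first by exists (w n).
  by rewrite jnormB (le_lt_trans (Hy n)) //; have : 0 < third n :> R := third_gt0 n; lra.
have Twe n k : rip (T (w (n + k).+1)) (e n) = third n.
  have Z m j : (j <= m)%N -> rip (T (w j)) (e m) = 0.
    elim: j => [|j IH] jm /=; first by rewrite linear0 rip0l.
    rewrite linearD ripDl Tv ripZl eE IH ?(ltnW jm) // addr0 (ltn_eqF jm) mulr0 //.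
  elim: k => [|k IH].
    by rewrite addn0 /= linearD ripDl Tv ripZl eE eqxx mulr1 Z // addr0.
  rewrite addnS [w _.+1]/= linearD ripDl Tv ripZl eE IH gtn_eqF ?mulr0 ?add0r //.
  by rewrite ltnS leq_addr.
(* Membership of [u] in [V] gives [third n * rip u (e n) = rip y (e n)], and the right side is
   [third n] by passage to the limit in [Twe]. *)
have [n] := Bess u; case/eqP.
apply: (mulfI (lt0r_neq0 (third_gt0 n))); rewrite -(proj1 (Vu n)) uy mulr1.
apply/eqP; rewrite -subr_eq0 -normr_le0; apply/ler_addgt0Pl => d d0; rewrite addr0.
have [|k kd] := @third_lt _ (d / 2); first by rewrite divr_gt0.
rewrite -(Twe n k) -ripNl -ripDl (le_trans (rip_le_abs _ _)) //.
have -> : jnorm (e n) = 1.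
  by apply/eqP; rewrite -(@eqrXn2 _ 2) ?jnorm_ge0 // -rip_norm eE eqxx expr1n.
rewrite mulr1 jnormB (le_trans (Hy _)) //.
have : third (n + k).+1 <= third k :> R by rewrite third_le // leqW // leq_addl.
lra.
Qed.

End NoInfiniteSequence.

(** Otherwise every finite orthonormal family in the kernel extends, and iterated choice yields the
    sequence excluded by [kernel_sequence_absurd]. *)
Lemma kernel_orthonormal_basis : exists s, [/\ orthonormals s,
  forall e, e \in s -> T e = 0 &
  forall u, T u = 0 -> (forall e, e \in s -> rip u e = 0) -> u = 0].
Proof.
apply: contrapT => H.
have /choice[F HF] s : exists u, orthonormals s -> (forall e, e \in s -> T e = 0) ->
    [/\ T u = 0, rip u u = 1 & forall e, e \in s -> rip u e = 0].
  have [os|] := pselect (orthonormals s); last by exists 0.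
  have [sN|] := pselect (forall e, e \in s -> T e = 0); last by exists 0.
  apply: contrapT => Hs; apply: H; exists s; split=> // u Tu us.
  apply/eqP/negPn/negP => u0; apply: Hs; exists ((jnorm u)^-1%:C *: u) => _ _.
  split; first by rewrite linearZ /= Tu scaler0.
    by rewrite ripZl ripZr rip_norm expr2 mulKf ?gt_eqF ?jnorm_gt0 // mulVf ?gt_eqF ?jnorm_gt0.
  by move=> e es; rewrite ripZl us // mulr0.
(* Adjoining ['i *: u] along with [u] makes each later vector orthogonal to [u] for the complex
   product, as [eiE] demands. *)
pose fix L n := if n is k.+1 then 'i%C *: F (L k) :: F (L k) :: L k else [::].
have Ti u : T u = 0 -> T ('i%C *: u) = 0 by move=> Tu; rewrite linearZ /= Tu scaler0.
have HL n : [/\ orthonormals (L n), forall e, e \in L n -> T e = 0 &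
    forall z, (forall e, e \in L n -> rip z e = 0) ->
      forall e, e \in L n -> rip ('i%C *: z) e = 0].
  elim: n => [|n [oL LN Li]]; first by split.
  have [Tu uu uL] := HF (L n) oL LN; rewrite /=; split.
  - split; last by split.
      by rewrite rip_ii.
    by move=> e; rewrite inE => /orP[/eqP ->|/(Li _ uL)//]; rewrite ripC rip_if.
  - by move=> e; rewrite !inE => /or3P[/eqP ->|/eqP ->|/LN//]; rewrite ?Ti.
  - move=> z zL e; rewrite !inE => /or3P[/eqP ->|/eqP ->|eL].
    + by rewrite rip_ii zL // !inE eqxx orbT.
    + by have := rip_ir z (F (L n)); rewrite zL ?inE ?eqxx // => ?; lra.
    + by apply: Li eL => e' e'L; apply: zL; rewrite !inE e'L !orbT.
pose e n := F (L n).
have He n : [/\ T (e n) = 0, rip (e n) (e n) = 1 & forall f, f \in L n -> rip (e n) f = 0].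
  by have [? ? _] := HL n; apply: HF.
have memL m n : (m < n)%N -> e m \in L n /\ 'i%C *: e m \in L n.
  elim: n => // n IH; rewrite ltnS leq_eqVlt => /orP[/eqP ->|/IH[h1 h2]].
    by rewrite /= !inE !eqxx orbT.
  by rewrite /= !inE h1 h2 !orbT.
have e_lt m n : (m < n)%N -> rip (e n) (e m) = 0 /\ rip (e n) ('i%C *: e m) = 0.
  by move=> /memL[h1 h2]; have [_ _ H3] := He n; rewrite !H3.
apply: (@kernel_sequence_absurd e).
- by move=> n; have [] := He n.
- move=> m n; case: ltngtP => [/e_lt[+ _]|/e_lt[-> _] //|->]; first by rewrite ripC.
  by have [] := He n.
- move=> m n; case: (ltngtP m n) => [/e_lt[_ +]|/e_lt[_ ->] //|->]; last exact: rip_if.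
  by move=> h; rewrite rip_ir ripC h oppr0.
(* If all coefficients of [v] were 1, Bessel's inequality on [L n] would give [n <= |v|^2] for every
   [n]. *)
move=> v; apply: contrapT => Hv.
have v1 n : rip v (e n) = 1 by apply/eqP/negPn/negP => h; apply: Hv; exists n.
have sum_ge n : n%:R <= \sum_(f <- L n) rip v f ^+ 2.
  elim: n => [|n IH]; first by rewrite big_nil.
  rewrite /= !big_cons -/(e n) v1 expr1n -natr1.
  have := sqr_ge0 (rip v ('i%C *: e n)); lra.
have [oL LN _] := HL (Num.truncn (jnorm v ^+ 2)).+1.
have [r [_ _ vE _]] := orthonormals_expand v (subspace_rsubspace (proj1 ker_closed_subspace)) LN oL.
have := sum_ge (Num.truncn (jnorm v ^+ 2)).+1.
rewrite leNgt => /negP; apply; apply: le_lt_trans (truncnS_gt _).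
by rewrite [leRHS]vE lerDr sqr_ge0.
Qed.

(** Split [w] along the kernel: the finite basis measures the kernel part exactly, and
    [coercive_on_kernel_orth] controls the rest. *)
Lemma semi_fredholm_bound : exists (C : R) s, 0 < C /\
  forall w, jnorm w ^+ 2 <= \sum_(e <- s) rip w e ^+ 2 + C ^+ 2 * jnorm (T w) ^+ 2.
Proof.
have [A AE] := adjoint_exists TM.
have [C C0 HC] := coercive_on_kernel_orth M0 TM AE Tsurj.
have [s [os sN sE]] := kernel_orthonormal_basis.
exists C, s; split=> // w; have [sK cK] := ker_closed_subspace.
have [p /= Tp Hp] := rproj_exists w (subspace_rsubspace sK) cK.
have [r [/= rN rs pE _]] := orthonormals_expand p (subspace_rsubspace sK) sN os.
have r0 : r = 0.
  by apply: sE => //; move: rN; rewrite linearB Tp sub0r => /eqP; rewrite oppr_eq0 => /eqP.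
have := HC (w - p) Hp; rewrite linearB Tp subr0 => wp.
have wE : jnorm w ^+ 2 = jnorm p ^+ 2 + jnorm (w - p) ^+ 2.
  by rewrite rip_sqrB; have := Hp p Tp; rewrite ripDl ripNl rip_norm => ?; lra.
rewrite wE pE r0 jnorm0 expr0n add0r lerD //.
  rewrite le_eqVlt; apply/orP; left; apply/eqP; apply: eq_big_seq => f fs.
  by have := Hp f (sN f fs); rewrite ripDl ripNl => ?; congr (_ ^+ 2); lra.
rewrite -exprMn lerXn2r ?nnegrE ?jnorm_ge0 // mulr_ge0 ?jnorm_ge0 // ltW //.
Qed.

End Kernel.

(** * Bessel families under an operator with a semi-Fredholm bound *)

Section BesselImage.
Context {R : realType} {K : kreinSpace R} {I : choiceType}.

Lemma subspace_image (T : {linear K -> K}) (V : set K) : subspace V -> subspace (T @` V).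
Proof.
move=> [V0 VD]; split; first by exists 0; rewrite ?linear0.
move=> a _ _ [f Vf <-] [g Vg <-]; exists (a *: f + g); first exact: VD.
by rewrite linearP.
Qed.

(** If [T w] is the projection of [f] onto the image of [W i], then [|T w|^2 = rip (A f) w], which
    brings in the projection of [A f] onto [W i]. The error terms [S i] are summed by applying the
    Bessel bound of [W] to each [e] in [s]. *)
Lemma Bessel_image (T : {linear K -> K}) (M C : R) (s : seq K) (W : I -> set K) (v : I -> R) :
  0 <= M -> (forall f, jnorm (T f) <= M * jnorm f) ->
  (forall w, jnorm w ^+ 2 <= \sum_(e <- s) rip w e ^+ 2 + C ^+ 2 * jnorm (T w) ^+ 2) ->
  (forall i, closed_subspace (W i)) -> Bessel W v -> Bessel (fun i => T @` W i) v.
Proof.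
move=> M0 TM Ts cW /Bessel_fset[B B0 HB].
have [A AE] := adjoint_exists TM.
pose E : R := \sum_(e <- s) B * jnorm e ^+ 2.
have E0 : 0 <= E by apply: sumr_ge0 => e _; rewrite mulr_ge0 ?sqr_ge0 // ltW.
apply/Bessel_fset; exists (2 * C ^+ 2 * B * M ^+ 2 + 2 * E + 1).
  have : 0 <= C ^+ 2 * B * M ^+ 2 by rewrite mulr_ge0 ?sqr_ge0 // mulr_ge0 ?sqr_ge0 // ltW.
  lra.
move=> f F; pose S i : R := \sum_(e <- s) jnorm (jproj (W i) e) ^+ 2.
have key i : jnorm (jproj (T @` W i) f) ^+ 2 <=
    2 * C ^+ 2 * jnorm (jproj (W i) (A f)) ^+ 2 + 2 * jnorm f ^+ 2 * S i.
  have sT := subspace_image T (proj1 (cW i)).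
  have := jproj_sqr f sT; have := jproj_le f sT; have := jproj_mem f sT.
  move: (jproj (T @` W i) f) => _ [w Ww <-] pf; rewrite AE => pE.
  have wS : \sum_(e <- s) rip w e ^+ 2 <= jnorm w ^+ 2 * S i.
    rewrite mulr_sumr; apply: ler_sum => e _; rewrite -exprMn ripC (rip_jproj e (cW i) Ww).
    by rewrite -real_normK ?num_real // lerXn2r ?nnegrE ?mulr_ge0 ?jnorm_ge0 // mulrC rip_le_abs.
  have := Ts w; have := rip_le_jproj (A f) (cW i) Ww; rewrite -pE => h1 h2.
  have S0 : 0 <= S i by apply: sumr_ge0 => e _; exact: sqr_ge0.
  have p0 := jnorm_ge0 (T w); have q0 := jnorm_ge0 (jproj (W i) (A f)); have w0 := jnorm_ge0 w.
  move: wS h1 h2 pf S0 p0 q0 w0; have f0 := jnorm_ge0 f; move: (S i) (jnorm (T w)) (jnorm w) f0.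
  move: (jnorm (jproj _ _)) (jnorm f) (\sum_(e <- s) _) => q n Z S' p d n0 wS h1 h2 pf S0 p0 q0 d0.
  have pn : p ^+ 2 <= n ^+ 2 by rewrite lerXn2r ?nnegrE.
  have C0 : 0 <= C ^+ 2 * q ^+ 2 by rewrite mulr_ge0 ?sqr_ge0.
  have nS : 0 <= n ^+ 2 * S' by rewrite mulr_ge0 ?sqr_ge0.
  (* For [S' <= 1/2] the error is absorbed: [d^2 <= 2 C^2 p^2], and [p^2 <= q d] gives
     [p^2 <= 2 C^2 q^2]. Otherwise [p^2 <= n^2 <= 2 n^2 S']. *)
  have [S1|S1] := leP S' (1 / 2).
    suff : p ^+ 2 <= 2 * C ^+ 2 * q ^+ 2 by lra.
    have dp : d ^+ 2 <= 2 * C ^+ 2 * p ^+ 2.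
      have : d ^+ 2 * S' <= d ^+ 2 * (1 / 2) by rewrite ler_wpM2l ?sqr_ge0.
      lra.
    have [->|pn0] := eqVneq p 0; first by rewrite expr0n /=; lra.
    have p2 : 0 < p ^+ 2 by rewrite exprn_gt0 // lt_def pn0.
    rewrite -(ler_pM2l p2).
    have : (p ^+ 2) * (p ^+ 2) <= (q * d) * (q * d) by rewrite ler_pM // ltW.
    have : q ^+ 2 * d ^+ 2 <= q ^+ 2 * (2 * C ^+ 2 * p ^+ 2) by rewrite ler_wpM2l ?sqr_ge0.
    lra.
  have : n ^+ 2 * (1 / 2) <= n ^+ 2 * S' by rewrite ler_wpM2l ?sqr_ge0 // ltW.
  lra.
have hA : \sum_(i <- F) v i ^+ 2 * jnorm (jproj (W i) (A f)) ^+ 2 <= B * (M ^+ 2 * jnorm f ^+ 2).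
  rewrite (le_trans (HB _ _)) // ler_wpM2l ?(ltW B0) // -exprMn lerXn2r ?nnegrE ?mulr_ge0 ?jnorm_ge0 //.
  exact: adjoint_le.
have hE : \sum_(i <- F) v i ^+ 2 * S i <= E.
  under eq_bigr => i _ do rewrite /S mulr_sumr.
  by rewrite exchange_big; apply: ler_sum => e _; exact: HB.
have step : \sum_(i <- F) v i ^+ 2 * jnorm (jproj (T @` W i) f) ^+ 2 <=
    2 * C ^+ 2 * (\sum_(i <- F) v i ^+ 2 * jnorm (jproj (W i) (A f)) ^+ 2) +
    2 * jnorm f ^+ 2 * (\sum_(i <- F) v i ^+ 2 * S i).
  rewrite !mulr_sumr -big_split /=; apply: ler_sum => i _.
  by have := ler_wpM2l (sqr_ge0 (v i)) (key i); lra.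
apply: le_trans step _.
have : 2 * C ^+ 2 * (\sum_(i <- F) v i ^+ 2 * jnorm (jproj (W i) (A f)) ^+ 2) <=
   2 * C ^+ 2 * (B * (M ^+ 2 * jnorm f ^+ 2)) by rewrite ler_wpM2l // mulr_ge0 ?sqr_ge0.
have : 2 * jnorm f ^+ 2 * (\sum_(i <- F) v i ^+ 2 * S i) <= 2 * jnorm f ^+ 2 * E.
  by rewrite ler_wpM2l // mulr_ge0 ?sqr_ge0.
have := sqr_ge0 (jnorm f); lra.
Qed.

End BesselImage.

(** * Transfer of fusion frames *)

Section Assembly.
Context {R : realType} {K : kreinSpace R} {I : choiceType}.
Implicit Types (f g x y : K) (s : R) (V U : set K) (W : I -> set K) (v : I -> R).
Variables (T : {linear K -> K}) (M : R).
Hypothesis M0 : 0 <= M.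
Hypothesis TM : forall f, jnorm (T f) <= M * jnorm f.
Hypothesis Tsurj : forall y, exists x, T x = y.

Lemma Jnonneg_qf V : Jnonneg V <-> forall f, V f -> 0 <= qf f.
Proof. by split=> H f /H; rewrite kform_qf ler0c. Qed.

Lemma Jneg_qf V : Jneg V <-> forall f, V f -> f <> 0 -> qf f < 0.
Proof. by split=> H f Vf f0; have := H f Vf f0; rewrite kform_qf ltcR. Qed.

Lemma unif_JposE_set : @unif_Jpos R K = unif_sign 1.
Proof. by apply/funext => V; apply/propext; exact: unif_JposE. Qed.

Lemma unif_JnegE_set : @unif_Jneg R K = unif_sign (-1).
Proof. by apply/funext => V; apply/propext; exact: unif_JnegE. Qed.

Lemma ell2_sum_image W (x : I -> K) : ell2_sum W x ->
  ell2_sum (fun i => T @` W i) (fun i => T (x i)).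
Proof.
move=> /ell2_sum_fset[Wx [b Hb]]; apply/ell2_sum_fset; split.
  by move=> i; exists (x i).
exists (M ^+ 2 * b) => F.
apply: le_trans (_ : M ^+ 2 * \sum_(i <- F) jnorm (x i) ^+ 2 <= _); last first.
  by rewrite ler_wpM2l ?sqr_ge0.
rewrite mulr_sumr; apply: ler_sum => i _; rewrite -exprMn.
by rewrite lerXn2r ?nnegrE ?mulr_ge0 ?jnorm_ge0.
Qed.

Lemma coord_proj_linear A (x : I -> K) :
  coord_proj A (fun i => T (x i)) = (fun i => T (coord_proj A x i)).
Proof.
by apply/funext => i; rewrite /coord_proj /patch; case: ifP => _ //; rewrite linear0.
Qed.

(** * Transfer along an operator bounded below that scales the form *)

Section BoundedBelow.
Variable C : R.
Hypothesis C0 : 0 < C.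
Hypothesis TC : forall x, jnorm x <= C * jnorm (T x).

Lemma bounded_below_inj : injective T.
Proof.
move=> x y xy; apply/eqP; rewrite -subr_eq0; apply/eqP/jnorm_eq0/eqP.
rewrite eq_le jnorm_ge0 andbT (le_trans (TC _)) // linearB xy subrr jnorm0 mulr0 //.
Qed.

Lemma bounded_below_closed_image V : closed_subspace V -> closed_subspace (T @` V).
Proof.
move=> [sV /closedP cV]; split; first exact: subspace_image.
apply/closedP => y; have [l <-] := Tsurj y => Hl; exists l => //; apply: cV => e e0.
have [|_ [u Vu <-]] := Hl (e / C); first by rewrite divr_gt0.
rewrite ltr_pdivlMr // => lu; exists u => //; apply: le_lt_trans (TC _) _.
by rewrite linearB mulrC.
Qed.

(** Preimages are chosen coordinate by coordinate; the lower bound on [T] keeps them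
    square-summable. *)
Lemma range_synthesis_image A W v : (forall i, closed_subspace (W i)) ->
  (forall i, 0 <= v i) -> Bessel W v ->
  range_synthesis_on A (fun i => T @` W i) v = T @` range_synthesis_on A W v.
Proof.
move=> cW v0 BW; have W0 i : W i 0 by have [[]] := cW i.
apply/seteqP; split=> [_ [y Hy <-]|_ [_ [x Hx <-] <-]].
  have /ell2_sum_fset[yT [b Hb]] := Hy.
  have /choice[x Hx] i : exists x, W i x /\ T x = y i by have [x ? ?] := yT i; exists x.
  have yE : y = fun i => T (x i) by apply/funext => i; case: (Hx i).
  have xW : ell2_sum W x.
    apply/ell2_sum_fset; split; first by move=> i; case: (Hx i).
    exists (C ^+ 2 * b) => F.
    apply: le_trans (_ : C ^+ 2 * \sum_(i <- F) jnorm (y i) ^+ 2 <= _); last first.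
      by rewrite ler_wpM2l ?sqr_ge0.
    rewrite mulr_sumr; apply: ler_sum => i _; rewrite -exprMn yE.
    by rewrite lerXn2r ?nnegrE ?mulr_ge0 ?jnorm_ge0 // ltW.
  exists (synthesis v (coord_proj A x)); first by exists x.
  rewrite yE coord_proj_linear.
  by rewrite (synthesis_linear cW v0 BW TM (ell2_sum_coord_proj A W0 xW)).
exists (fun i => T (x i)); first exact: ell2_sum_image.
rewrite coord_proj_linear.
by rewrite (synthesis_linear cW v0 BW TM (ell2_sum_coord_proj A W0 Hx)).
Qed.

Variable c : R.
Hypothesis c0 : 0 < c.
Hypothesis Tc : forall x, qf (T x) = c * qf x.

(** A larger uniformly definite [U] pulls back to a uniformly definite subspace containing [V];
    maximality of [V] and surjectivity of [T] conclude. *)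
Lemma maximal_unif_image s V :
  maximal_subspace (unif_sign s) V -> maximal_subspace (unif_sign s) (T @` V).
Proof.
move=> [sV [al al0 Hal] maxV]; split; first exact: subspace_image.
  have M1 : 0 < M ^+ 2 + 1 by rewrite ltr_wpDl ?sqr_ge0.
  exists (c * al / (M ^+ 2 + 1)); first by rewrite divr_gt0 // mulr_gt0.
  move=> _ [x Vx <-]; rewrite Tc mulrAC ler_pdivrMr //.
  have h1 : jnorm (T x) ^+ 2 <= M ^+ 2 * jnorm x ^+ 2.
    by rewrite -exprMn lerXn2r ?nnegrE ?mulr_ge0 ?jnorm_ge0.
  have h2 := ler_wpM2l (mulr_ge0 (ltW c0) (ltW al0)) h1.
  have h3 := ler_wpM2l (mulr_ge0 (ltW c0) (ltW (ltr_wpDl (sqr_ge0 M) ltr01))) (Hal _ Vx).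
  have h4 : 0 <= c * al * jnorm x ^+ 2 by rewrite mulr_ge0 ?sqr_ge0 // mulr_ge0 // ltW.
  lra.
move=> U [U0 UD] [be be0 Hbe] VU.
have <- : [set x | U (T x)] = V.
  apply: maxV; last by move=> x Vx; apply: VU; exists x.
    by split=> [|a f g /= Uf Ug]; rewrite /= ?linear0 // linearP; exact: UD.
  exists (be / (c * C ^+ 2)); first by rewrite divr_gt0 // mulr_gt0 // exprn_gt0.
  move=> x /= /Hbe; rewrite Tc => h1; rewrite mulrAC ler_pdivrMr ?mulr_gt0 ?exprn_gt0 //.
  have h2 : jnorm x ^+ 2 <= C ^+ 2 * jnorm (T x) ^+ 2.
    by rewrite -exprMn lerXn2r ?nnegrE ?mulr_ge0 ?jnorm_ge0 // ltW.
  have h3 := ler_wpM2l (ltW be0) h2; have h4 := ler_wpM2l (sqr_ge0 C) h1; lra.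
apply/seteqP; split=> [y Uy|_ [x Ux <-] //].
by have [x xy] := Tsurj y; exists x => //=; rewrite xy.
Qed.

Lemma image_eq0 V : (T @` V = [set 0]) = (V = [set 0]).
Proof.
apply/propext; split=> [H|->]; last by rewrite image_set1 linear0.
apply/seteqP; split=> [x Vx|_ ->].
  have : (T @` V) (T x) by exists x.
  by rewrite H => /= Tx; apply: bounded_below_inj; rewrite Tx linear0.
have : (T @` V) 0 by rewrite H.
by move=> [x Vx Tx]; rewrite (_ : 0 = x) //; apply: bounded_below_inj; rewrite Tx linear0.
Qed.

Lemma Jnonneg_image V : Jnonneg (T @` V) = Jnonneg V.
Proof.
apply/propext; rewrite !Jnonneg_qf; split=> H => [f Vf|_ [f Vf <-]].
  by have := H (T f) (imageP T Vf); rewrite Tc pmulr_rge0.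
by rewrite Tc pmulr_rge0 // H.
Qed.

Lemma Jneg_image V : Jneg (T @` V) = Jneg V.
Proof.
apply/propext; rewrite !Jneg_qf; split=> H => [f Vf f0|_ [f Vf <-] f0].
  have := H (T f) (imageP T Vf); rewrite Tc pmulr_rlt0 //; apply => Tf; apply: f0.
  by apply: bounded_below_inj; rewrite Tf linear0.
by rewrite Tc pmulr_rlt0 // H // => fE; apply: f0; rewrite fE linear0.
Qed.

Lemma J_fusion_frame_similarity W v :
  J_fusion_frame W v -> J_fusion_frame (fun i => T @` W i) v.
Proof.
rewrite /J_fusion_frame unif_JposE_set unif_JnegE_set => -[wW BW mp mn].
have cW i : closed_subspace (W i) by have [] := wW i.
have v0 i : 0 <= v i by have [_ /ltW] := wW i.
have ->: Iplus (fun i => T @` W i) = Iplus W.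
  by apply/funext => i; rewrite /Iplus /= Jnonneg_image.
have ->: Iminus (fun i => T @` W i) = Iminus W.
  by apply/funext => i; rewrite /Iminus /= Jneg_image image_eq0.
rewrite !range_synthesis_image //; split.
- move=> i; have [? ? ?] := wW i.
  by rewrite Jneg_image Jnonneg_image; split=> //; exact: bounded_below_closed_image.
(* Boundedness below is the semi-Fredholm bound without error terms. *)
- apply: (@Bessel_image _ _ _ T M C [::]) => // w.
  by rewrite big_nil add0r -exprMn lerXn2r ?nnegrE ?mulr_ge0 ?jnorm_ge0 // ltW.
- exact: maximal_unif_image.
- exact: maximal_unif_image.
Qed.

End BoundedBelow.

(** * Transfer when the form is semidefinite *)

Section DefiniteSpace.
Variable s : R.
Hypothesis s2 : s ^+ 2 = 1.
Hypothesis sq : forall f, 0 <= s * qf f.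

(** The vector [g = f - s J f] satisfies [J g = - s g], so [s * qf g = - |g|^2]; semidefiniteness
    forces [g = 0], that is [f = s J f]. *)
Lemma qf_definite f : s * qf f = jnorm f ^+ 2.
Proof.
pose g := f - s%:C *: ksym K f.
have gJ : ksym K g = - s%:C *: g.
  by rewrite /g linearB linearZ /= ksymK scaleNr scalerBr scalerA -rmorphM -expr2 s2 rmorph1 scale1r opprB.
have g0 : g = 0.
  apply/jnorm_eq0/eqP; rewrite -sqrf_eq0 eq_le sqr_ge0 andbT.
  have := sq g; rewrite qf_jdot gJ -rmorphN ripZl mulrA mulrN -expr2 s2 mulN1r rip_norm.
  by rewrite oppr_ge0.
move/eqP: g0; rewrite subr_eq0 => /eqP fE.
by rewrite qf_jdot -ripZl -fE rip_norm.
Qed.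

Lemma definite_unif V : unif_sign s V.
Proof. by exists 1 => // f _; rewrite mul1r qf_definite. Qed.

Lemma definite_unifN V : subspace V -> unif_sign (- s) V -> V = [set 0].
Proof.
move=> [V0 _] [al al0 H]; apply/seteqP; split=> [x Vx|_ -> //].
apply/jnorm_eq0/eqP; rewrite -sqrf_eq0 eq_le sqr_ge0 andbT.
have := H x Vx; rewrite mulNr qf_definite; have := sqr_ge0 (jnorm x); nra.
Qed.

(** The whole space is uniformly definite of sign [s], so maximality makes the range everything, and
    surjectivity of [T] transports this. [A] and [A'] may differ but both retain every
    coordinate. *)
Lemma maximal_definite_full A A' W v : (forall i, closed_subspace (W i)) ->
  (forall i, 0 <= v i) -> Bessel W v ->
  (forall x : I -> K, (forall i, W i (x i)) -> coord_proj A x = x) ->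
  (forall x : I -> K, (forall i, (T @` W i) (x i)) -> coord_proj A' x = x) ->
  maximal_subspace (unif_sign s) (range_synthesis_on A W v) ->
  maximal_subspace (unif_sign s) (range_synthesis_on A' (fun i => T @` W i) v).
Proof.
move=> cW v0 BW AW A'W [_ _ maxV].
have full : [set: K] = range_synthesis_on A W v.
  by apply: maxV => //; exact: definite_unif.
have -> : range_synthesis_on A' (fun i => T @` W i) v = [set: K].
  apply/seteqP; split=> // y _; have [f <-] := Tsurj y.
  have [x Hx <-] : range_synthesis_on A W v f by rewrite -full.
  have [xW _] := Hx; exists (fun i => T (x i)); first exact: ell2_sum_image.
  rewrite AW // A'W => [|i]; last by exists (x i).
  exact: synthesis_linear cW v0 BW TM Hx.
split=> //; first exact: definite_unif.
by move=> U _ _ TU; apply/seteqP; split.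
Qed.

Lemma maximal_definite_zero A W v : (forall i, subspace (W i)) ->
  (forall x : I -> K, (forall i, W i (x i)) -> coord_proj A x = fun=> 0) ->
  maximal_subspace (unif_sign (- s)) (range_synthesis_on A W v).
Proof.
move=> sW AW.
have -> : range_synthesis_on A W v = [set 0].
  apply/seteqP; split=> [_ [x [Wx _] <-]|_ ->]; first by rewrite AW //= synthesis0.
  exists (fun=> 0); last by rewrite AW ?synthesis0 // => i; have [] := sW i.
  apply/ell2_sum_fset; split=> [i|]; first by have [] := sW i.
  by exists 0 => F; rewrite big1 // => i _; rewrite jnorm0 expr0n.
split=> [||U sU uU _]; last exact: definite_unifN.
- by split=> // a f g -> ->; rewrite scaler0 addr0.
- by exists 1 => // f ->; rewrite jnorm0 qf0 expr0n !mulr0.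
Qed.

End DefiniteSpace.

Section DefiniteFrame.
Hypothesis Tclosed : forall V, closed_subspace V -> closed_subspace (T @` V).

Lemma Bessel_image_closed W v : (forall i, closed_subspace (W i)) ->
  Bessel W v -> Bessel (fun i => T @` W i) v.
Proof.
have [C [s [_ H]]] := semi_fredholm_bound M0 TM Tsurj Tclosed.
exact: Bessel_image M0 TM H.
Qed.

Lemma coord_proj_full (A : set I) W (x : I -> K) : (forall i, ~ A i -> W i = [set 0]) ->
  (forall i, W i (x i)) -> coord_proj A x = x.
Proof.
move=> AW Wx; apply/funext => i; rewrite /coord_proj /patch; case: ifPn => //.
by move=> /negP iA; have := Wx i; rewrite AW // => Ai; apply: iA; exact: mem_set.
Qed.

Lemma coord_proj_empty (A : set I) W (x : I -> K) : (forall i, A i -> W i = [set 0]) ->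
  (forall i, W i (x i)) -> coord_proj A x = fun=> 0.
Proof.
move=> AW Wx; apply/funext => i; rewrite /coord_proj /patch; case: ifPn => //.
by move=> /set_mem/AW W0; have := Wx i; rewrite W0.
Qed.

Lemma J_fusion_frame_nonneg W v : (forall f, 0 <= qf f) ->
  J_fusion_frame W v -> J_fusion_frame (fun i => T @` W i) v.
Proof.
rewrite /J_fusion_frame unif_JposE_set unif_JnegE_set => q0 [wW BW mp _].
have q1 f : 0 <= 1 * qf f by rewrite mul1r.
have cW i : closed_subspace (W i) by have [] := wW i.
have v0 i : 0 <= v i by have [_ /ltW] := wW i.
have cTW i : closed_subspace (T @` W i) by exact: Tclosed.
have pos V : Jnonneg V by apply/Jnonneg_qf.
split.
- by move=> i; have [_ vi _] := wW i; split=> //; left.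
- exact: Bessel_image_closed.
- apply: maximal_definite_full mp => //; first by rewrite expr1n.
    by move=> x Wx; apply: (@coord_proj_full _ W _ _ Wx) => i []; exact: pos.
  by move=> x Wx; apply: (@coord_proj_full _ (fun i => T @` W i) _ _ Wx) => i []; exact: pos.
- apply: maximal_definite_zero => //; first by rewrite expr1n.
    by move=> i; case: (cTW i).
  move=> x Wx; apply: (@coord_proj_empty _ (fun i => T @` W i) _ _ Wx) => i [_ /Jneg_qf neg].
  apply/seteqP; split=> [f Vf|_ ->]; last by have [[]] := cTW i.
  by apply: contrapT => /(neg f Vf); rewrite ltNge q0.
Qed.

(** Not a mirror image of the non-negative case: a zero subspace counts as non-negative, so [Iplus]
    may be nonempty and [Iminus] omits such indices. Their coordinates vanish, so the ranges are
    unaffected. *)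
Lemma J_fusion_frame_nonpos W v : (forall f, qf f <= 0) ->
  J_fusion_frame W v -> J_fusion_frame (fun i => T @` W i) v.
Proof.
rewrite /J_fusion_frame unif_JposE_set unif_JnegE_set => q0 [wW BW _ mn].
have q1 f : 0 <= -1 * qf f by rewrite mulN1r oppr_ge0.
have s2 : (-1 : R) ^+ 2 = 1 by rewrite sqrrN expr1n.
have cW i : closed_subspace (W i) by have [] := wW i.
have v0 i : 0 <= v i by have [_ /ltW] := wW i.
have cTW i : closed_subspace (T @` W i) by exact: Tclosed.
have neg V : Jneg V.
  apply/Jneg_qf => f _ f0; have := qf_definite s2 q1 f.
  have : 0 < jnorm f ^+ 2 by rewrite exprn_gt0 // jnorm_gt0 //; apply/eqP.
  lra.
split.
- by move=> i; have [_ vi _] := wW i; split=> //; right.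
- exact: Bessel_image_closed.
- rewrite -(opprK (1 : R)); apply: maximal_definite_zero => //.
    by move=> i; case: (cTW i).
  move=> x Wx; apply: (@coord_proj_empty _ (fun i => T @` W i) _ _ Wx) => i /Jnonneg_qf pos.
  apply/seteqP; split=> [f Vf|_ ->]; last by have [[]] := cTW i.
  apply/jnorm_eq0/eqP; rewrite -sqrf_eq0 eq_le sqr_ge0 andbT -(qf_definite s2 q1).
  by have := pos f Vf; lra.
- apply: maximal_definite_full mn => //.
    by move=> x Wx; apply: (@coord_proj_full _ W _ _ Wx) => i H; apply: contrapT => W0; apply: H.
  by move=> x Wx; apply: (@coord_proj_full _ (fun i => T @` W i) _ _ Wx) => i H; apply: contrapT => W0; apply: H.
Qed.

End DefiniteFrame.
End Assembly.

Theorem theorem2p16 (R : realType) (K : kreinSpace R) (T : {linear K -> K})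
    (Tbounded : bounded_operator T)
    (Tsurj : T @` [set: K] = [set: K])
    (Tdef : preserves_definiteness_with_sign T)
    (Tmax : preserves_maximality T)
    (Treg : preserves_regularity T)
    (I : choiceType) (W : I -> set K) (v : I -> R) :
  J_fusion_frame W v -> J_fusion_frame (fun i => T @` W i) v.
Proof.
have [M M0 TM] : exists2 M : R, 0 <= M & forall f, jnorm (T f) <= M * jnorm f.
  have [M TM] := Tbounded; exists `|M| => // f.
  by rewrite (le_trans (TM f)) // ler_wpM2r ?jnorm_ge0 // ler_norm.
have Ts y : exists x, T x = y.
  by have : [set: K] y by []; rewrite -Tsurj => -[x _ <-]; exists x.
have Tunif (s : R) V : s = 1 \/ s = -1 -> closed_subspace V -> unif_sign s V ->
    closed_subspace (T @` V) /\ unif_sign s (T @` V).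
  have [Tp Tn] := Tdef.
  case=> -> cV uV.
    by have [|? /unif_JposE ?] := Tp V; first by split=> //; apply/unif_JposE.
  by have [|? /unif_JnegE ?] := Tn V; first by split=> //; apply/unif_JnegE.
(* Preservation of definiteness is applied to the closed complex line through [x]. *)
have Tsign (s : R) x : s = 1 \/ s = -1 -> 0 < s * qf x ->
    exists2 al : R, 0 < al & al * jnorm (T x) ^+ 2 <= s * qf (T x).
  move=> ss /complex_line_unif/(Tunif _ _ ss (complex_line_closed x))[_ [al al0 H]].
  by exists al => //; apply: H; exists x => //; exact: complex_line_id.
have [neg|noneg] := pselect (exists x : K, qf x < 0); last first.
  have q0 (f : K) : 0 <= qf f by rewrite leNgt; apply/negP => ?; apply: noneg; exists f.
  (* Every closed subspace is uniformly positive here, so [Tunif] yields the closedness of its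
     image. *)
  apply: (J_fusion_frame_nonneg M0 TM Ts _ q0) => // V cV.
  apply: (proj1 (Tunif 1 V (or_introl erefl) cV _)).
  by apply: definite_unif; [rewrite expr1n|move=> f; rewrite mul1r].
have [pos|nopos] := pselect (exists x : K, 0 < qf x); last first.
  have q0 (f : K) : qf f <= 0 by rewrite leNgt; apply/negP => ?; apply: nopos; exists f.
  apply: (J_fusion_frame_nonpos M0 TM Ts _ q0) => // V cV.
  apply: (proj1 (Tunif (-1) V (or_intror erefl) cV _)).
  by apply: definite_unif; [rewrite sqrrN expr1n|move=> f; rewrite mulN1r oppr_ge0].
have indef (s : R) : s = 1 \/ s = -1 -> exists x : K, 0 < s * qf x.
  case=> ->; first by have [x ?] := pos; exists x; rewrite mul1r.
  by have [x ?] := neg; exists x; rewrite mulN1r oppr_gt0.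
have [C C0 TC] := T_bounded_below TM Ts Tsign indef.
have [c c0 Tc] := T_scaling Ts Tsign indef.
by move=> WJ; apply: (J_fusion_frame_similarity M0 TM Ts C0 TC c0 Tc WJ).
Qed.
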